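(* Let $\alpha\in(0,1)$. The density of the random variable $W_\alpha$ is completely monotone on its domain of definition, i.e. on the (open) half-line that is the interior of the support of $W_\alpha$.
   Context: For $\alpha\in(0,1)$ put $\beta=1-\alpha$ and $$b_\alpha(u)=\Big(\frac{\sin u}{\sin(\alpha u)}\Big)^{\alpha}\Big(\frac{\sin u}{\sin(\beta u)}\Big)^{\beta},\qquad u\in(0,\pi).$$ The function $b_\alpha$ is decreasing on $(0,\pi)$. Let $U$ be uniformly distributed on $(0,\pi)$ and set $$V_\alpha=b_\alpha(U)^{-1/\beta},\qquad W_\alpha=\log V_\alpha=-\frac1\beta\log b_\alpha(U).$$ The support of $V_\alpha$ is $[\beta\alpha^{\alpha/\beta},\infty)$ and the support of $W_\alpha$ is $[\log(\beta\alpha^{\alpha/\beta}),\infty)$. A function $f$ on an open half-line $(c,\infty)$ is completely monotone if it is smooth and $(-1)^nf^{(n)}\ge 0$ on $(c,\infty)$ for all $n\ge 0$. *)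

(* Defs.v *)
From HB Require Import structures.
From mathcomp Require Import all_boot all_order all_algebra.
From mathcomp Require Import all_classical all_reals all_analysis.
From mathcomp Require Import measurable_realfun.

Set Implicit Arguments.
Unset Strict Implicit.
Unset Printing Implicit Defensive.

Import Order.TTheory GRing.Theory Num.Theory.
Import numFieldNormedType.Exports.

Local Open Scope classical_set_scope.
Local Open Scope ring_scope.

(* The formulas below are only meaningful for 0 < u < pi; as [sin], [_ / _],
   [_ `^ _] and [ln] are total, the functions take irrelevant values elsewhere,
   which a uniform variable on (0, pi) avoids almost surely. *)
Definition b_fun (R : realType) (alpha u : R) : R :=
  (sin u / sin (alpha * u)) `^ alpha
  * (sin u / sin ((1 - alpha) * u)) `^ (1 - alpha).

Definition V_fun (R : realType) (alpha u : R) : R :=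
  b_fun alpha u `^ (- (1 - alpha)^-1).

Definition W_fun (R : realType) (alpha u : R) : R := ln (V_fun alpha u).

Lemma measurable_invr (R : realType) :
  measurable_fun [set: R] (fun x : R => x^-1).
Proof.
have -> : [set: R] = [set 0] `|` ~` [set 0] by rewrite setUv.
apply/measurable_funU => //; first exact: measurableC.
split; first exact: measurable_fun_set1.
have o0 : open (~` [set (0 : R)]).
  by rewrite openC; apply: accessible_closed_set1; exact: hausdorff_accessible.
apply: subspace_continuous_measurable_fun; first exact: measurableC.
rewrite continuous_open_subspace// => x; rewrite inE/= => /eqP x0.
exact: inv_continuous.
Qed.

Lemma measurable_sin_ratio (R : realType) (a : R) :
  measurable_fun [set: R] (fun u : R => sin u / sin (a * u)).
Proof.
have msin : measurable_fun [set: R] (@sin R).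
  by apply: continuous_measurable_fun; exact: continuous_sin.
apply: measurable_funM => //.
apply: (measurableT_comp (@measurable_invr R)).
apply: (measurableT_comp msin).
exact: measurable_funM.
Qed.

Lemma measurable_W_fun (R : realType) (alpha : R) :
  measurable_fun [set: R] (W_fun alpha).
Proof.
apply: (measurableT_comp (@measurable_ln R)).
apply: (measurableT_comp (measurable_powR _)).
apply: measurable_funM; apply: (measurableT_comp (measurable_powR _));
  exact: measurable_sin_ratio.
Qed.

HB.instance Definition _ (R : realType) (alpha : R) :=
  isMeasurableFun.Build _ _ R R (W_fun alpha) (@measurable_W_fun R alpha).

Definition W_rv (d : measure_display) (T : measurableType d) (R : realType)
    (P : probability T R) (alpha : R) (U : {RV P >-> R}) : {RV P >-> R} :=
  (W_fun alpha \o U : {mfun T >-> R}).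

(* [uniform_prob] is given by the constant density on the closed interval
   [0, pi], which is the same law as on the open one. *)
Definition uniform_on_0_pi (d : measure_display) (T : measurableType d)
    (R : realType) (P : probability T R) (U : {RV P >-> R}) : Prop :=
  forall A : set R, measurable A ->
    distribution P U A = uniform_prob (pi_gt0 R) A.

Definition support_rv (d : measure_display) (T : measurableType d)
    (R : realType) (P : probability T R) (X : {RV P >-> R}) : set R :=
  [set x | forall e : R, 0 < e -> (0 < distribution P X (ball x e))%E].

Definition is_density (d : measure_display) (T : measurableType d)
    (R : realType) (P : probability T R) (X : {RV P >-> R}) (f : R -> R)
    : Prop :=
  [/\ measurable_fun [set: R] f, (forall x, 0 <= f x) &
    forall A : set R, measurable A ->
      distribution P X A = (\int[lebesgue_measure]_(x in A) (f x)%:E)%E].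

Definition completely_monotone (R : realType) (c : R) (f : R -> R) : Prop :=
  forall (n : nat) (x : R), c < x ->
    derivable (derive1n n f) x 1 /\ 0 <= (-1) ^+ n * derive1n n f x.

(* Main.v *)
(* Put y = 1 + z y^alpha, beta = 1 - alpha and z = x exp (- i pi beta).
   Comparing the imaginary parts of this equation and of its quotient by y
   gives x = b_alpha (pi - v), where v = - arg y, so that v = pi - u inverts
   the Kanter function b_alpha.  By Lagrange's expansion of log y,
     v = sum_n a_n x^n,
     a_n = sin (pi beta n) (1 - beta n) ... (n - 1 - beta n) / n!,
   and a_n >= 0 since the sine and the product change sign together.  The
   series converges for x < alpha^-alpha beta^-beta = b_alpha (0+), that is, on
   the whole range of b_alpha.  As W_alpha = w means x = exp (- beta w), the
   tail P (W_alpha > w) is v / pi = sum_n (a_n / pi) exp (- beta n w), and the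
   density (beta / pi) sum_n n a_n exp (- beta n w) is a nonnegative combination
   of decreasing exponentials. *)
Require Import Defs.
From HB Require Import structures.
From mathcomp Require Import all_boot all_order all_algebra.
From mathcomp Require Import all_classical all_reals all_analysis.
From mathcomp Require Import measurable_realfun ring lra zify.
Import Order.TTheory GRing.Theory Num.Theory.
Import numFieldNormedType.Exports.
Local Open Scope classical_set_scope.
Local Open Scope ring_scope.

Set Implicit Arguments.
Unset Strict Implicit.
Unset Printing Implicit Defensive.

(** * Lagrange coefficients of y = 1 + z y^al *)

(** No complex function enters. The powers y^c, for all c at once, are given by their Taylor
    coefficients, and Lagrange's expansion becomes two coefficient identities: the relation (y^c)' =
    c (log y)' y^c, obtained from a convolution that is a polynomial identity in c, and an index
    shift that encodes y = 1 + z y^alpha. On the ray carrying z the former is a real linear system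
    in x, solved only by exp (c log y). Hence c = 1 and c = alpha share one modulus and one
    argument, and no branch of a power has to be chosen.

    Convergence is required all the way up to b_alpha (0+), so the coefficient bound may not lose an
    exponential factor. Comparison with the largest binomial weight loses only a factor linear in n.

    Reading b_alpha (pi - v) = x off the two imaginary parts presupposes 0 < v < pi. The upper bound
    is not visible on the series; it comes from an intermediate value argument that uses the
    identity at smaller x and the behaviour of b_alpha near 0. *)

Section GeneralizedBinomialSeries.
Variable F : numFieldType.
Implicit Types (a r s : F) (n : nat).

Definition falling a n := \prod_(i < n) (a - i%:R).

Lemma fallingS a n : falling a n.+1 = falling a n * (a - n%:R).
Proof. by rewrite /falling big_ord_recr. Qed.

Lemma falling_shift a n : falling (a + 1) n.+1 = (a + 1) * falling a n.
Proof.
rewrite /falling big_ord_recl subr0; congr (_ * _); apply: eq_bigr => i _.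
by rewrite lift0 -natr1; ring.
Qed.

Variable al : F.

(* With [y = 1 + z y^al], these are the coefficients of [z^n] in
   [y^(s + 1) / (al + (1 - al) y)] and in [y^r] respectively. *)
Definition ratio_coef s n := falling (s + al * n%:R) n / n`!%:R.

Definition power_coef r n :=
  if n is m.+1 then r * falling (r + al * n%:R - 1) m / n`!%:R else 1.

Lemma factr_neq0 n : n`!%:R != 0 :> F.
Proof. by rewrite pnatr_eq0 -lt0n fact_gt0. Qed.

(** Coefficient of z^(n+1) in y = 1 + z y^al multiplied by y^(s+1) / (al + (1 - al) y). Multiplying
    by y^r instead gives [power_coefB]. *)
Lemma ratio_coefB s n :
  ratio_coef (s + 1) n.+1 = ratio_coef s n.+1 + ratio_coef (s + al) n.
Proof.
rewrite /ratio_coef factS natrM.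
have -> : s + 1 + al * n.+1%:R = s + al * n.+1%:R + 1 by ring.
have -> : s + al + al * n%:R = s + al * n.+1%:R by rewrite -natr1; ring.
rewrite falling_shift fallingS.
have n0 : n.+1%:R != 0 :> F by rewrite pnatr_eq0.
have f0 := factr_neq0 n.
rewrite -natr1 in n0 *.
by field; rewrite n0 f0.
Qed.

Lemma power_coefB r n :
  power_coef (r + 1) n.+1 = power_coef r n.+1 + power_coef (r + al) n.
Proof.
case: n => [|n].
  by rewrite /power_coef /falling !big_ord0 (_ : 1`! = 1%N)//; field.
rewrite /power_coef factS natrM.
have -> : r + 1 + al * n.+2%:R - 1 = (r + al * n.+2%:R - 1) + 1 by ring.
have -> : r + al + al * n.+1%:R - 1 = r + al * n.+2%:R - 1.
  by rewrite -(natr1 n.+1); ring.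
rewrite falling_shift fallingS.
have n0 : n.+2%:R != 0 :> F by rewrite pnatr_eq0.
have f0 := factr_neq0 n.+1.
rewrite -(natr1 n.+1) -(natr1 n) in n0 *.
by field; rewrite n0 f0.
Qed.

Lemma poly_nat_eq0 (p : {poly F}) : (forall m : nat, p.[m%:R] = 0) -> p = 0.
Proof.
move=> p0; apply/eqP/negPn/negP => pN0.
pose rs : seq F := [seq i%:R | i <- iota 0 (size p)].
have rs_root : all (root p) rs by apply/allP => x /mapP[i _ ->]; apply/eqP.
have rs_uniq : uniq rs.
  by rewrite map_inj_uniq ?iota_uniq// => i j /eqP; rewrite eqr_nat => /eqP.
have := max_poly_roots pN0 rs_root rs_uniq.
by rewrite size_map size_iota ltnn.
Qed.

Let ratio_poly s n : {poly F} :=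
  (n`!%:R)^-1 *: \prod_(i < n) ('X + (s + al * n%:R - i%:R)%:P).
Let power_poly n : {poly F} := if n is m.+1 then
  (n`!%:R)^-1 *: ('X * \prod_(i < m) ('X + (al * n%:R - 1 - i%:R)%:P)) else 1.

Let horner_ratio_poly s n r : (ratio_poly s n).[r] = ratio_coef (r + s) n.
Proof.
rewrite /ratio_poly hornerZ horner_prod mulrC /ratio_coef; congr (_ / _).
by apply: eq_bigr => i _; rewrite hornerD hornerX hornerC; ring.
Qed.

Let horner_power_poly n r : (power_poly n).[r] = power_coef r n.
Proof.
case: n => [|n]; first by rewrite hornerC.
rewrite /power_poly hornerZ hornerM hornerX horner_prod mulrC /power_coef.
by congr (_ * _ / _); apply: eq_bigr => i _; rewrite hornerD hornerX hornerC; ring.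
Qed.

(* Both sides are polynomials in [r] with the same finite difference. *)
Lemma ratio_power_convolution r s n :
  \sum_(k < n.+1) ratio_coef s k * power_coef r (n - k) = ratio_coef (r + s) n.
Proof.
elim: n r s => [r s|n IHn r s].
  by rewrite big_ord1 /= mulr1 /ratio_coef /falling !big_ord0.
pose D : {poly F} :=
  \sum_(k < n.+2) ratio_coef s k *: power_poly (n.+1 - k) - ratio_poly s n.+1.
have DE (t : F) : D.[t] = \sum_(k < n.+2) ratio_coef s k * power_coef t (n.+1 - k)
    - ratio_coef (t + s) n.+1.
  rewrite /D hornerD hornerN horner_ratio_poly horner_sum; congr (_ - _).
  by apply: eq_bigr => k _; rewrite hornerZ horner_power_poly.
suff D0 : D = 0 by apply/eqP; rewrite -subr_eq0 -DE D0 horner0.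
apply: poly_nat_eq0; elim => [|m IHm].
  rewrite DE big_ord_recr /= subnn mulr1 big1 ?add0r ?subrr// => k _.
  have -> : (n.+1 - k = (n - k).+1)%N by have := ltn_ord k; lia.
  by rewrite /power_coef !mul0r mulr0.
(* Passing from [m] to [m + 1] adds the convolution of order [n] at the exponent [m + al], which
   [IHn] evaluates. *)
have convS : \sum_(k < n.+2) ratio_coef s k * power_coef (m%:R + 1) (n.+1 - k) =
    \sum_(k < n.+2) ratio_coef s k * power_coef m%:R (n.+1 - k)
    + ratio_coef (m%:R + al + s) n.
  rewrite -IHn 2!(big_ord_recr n.+1) /= !subnn addrAC; congr (_ + _).
  rewrite -big_split /=; apply: eq_bigr => k _.
  have -> : (n.+1 - k = (n - k).+1)%N by have := ltn_ord k; lia.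
  by rewrite power_coefB mulrDr.
rewrite DE -natr1 convS (addrAC _ 1) ratio_coefB.
by rewrite (addrAC _ s) opprD addrACA -DE IHm subrr addr0.
Qed.

(** Differentiating y = 1 + z y^al gives (log y)' = y^al / (al + (1 - al) y), whose coefficients are
    [ratio_coef (al - 1)]; the recurrence is thus (y^r)' = r (log y)' y^r. *)
Lemma power_coef_recurrence r n : n.+1%:R * power_coef r n.+1 =
  r * \sum_(k < n.+1) ratio_coef (al - 1) k * power_coef r (n - k).
Proof.
rewrite ratio_power_convolution /power_coef /ratio_coef factS natrM.
have -> : r + (al - 1) + al * n%:R = r + al * n.+1%:R - 1.
  by rewrite -natr1; ring.
have n0 : n.+1%:R != 0 :> F by rewrite pnatr_eq0.
have f0 := factr_neq0 n.
rewrite -(natr1 n) in n0 *.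
by field; rewrite n0 f0.
Qed.

(** The equation y = 1 + z y^al itself, read on coefficients. *)
Lemma power_coef1S n : power_coef 1 n.+1 = power_coef al n.
Proof.
have := power_coefB 0 n; rewrite !add0r => ->.
by rewrite {1}/power_coef !mul0r add0r.
Qed.

End GeneralizedBinomialSeries.

(** * Sign and growth of the coefficients *)

Section CoefficientEstimates.
Variable R : realType.
Implicit Types (x t al : R) (n k : nat).

Lemma falling_rev al n :
  falling (al - 1 + al * n%:R) n = \prod_(i < n) (i.+1%:R - (1 - al) * n.+1%:R).
Proof.
rewrite /falling (reindex_inj rev_ord_inj); apply: eq_bigr => i _ /=.
by rewrite natrB ?ltn_ord// -!natr1; ring.
Qed.

(** If the last factor is negative, replace [t] by [t - 1]: the sine changes sign, the first factor
    [1 - t] is nonpositive and absorbs that sign, and the other factors are those of the shorter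
    product at [t - 1]. *)
Lemma sin_prod_ge0 n t : 0 <= t <= n.+1%:R ->
  0 <= sin (pi * t) * \prod_(i < n) (i.+1%:R - t).
Proof.
elim: n t => [|n IHn] t /andP[t0 tn].
  rewrite big_ord0 mulr1 sin_ge0_pi// mulr_ge0 ?pi_ge0//=.
  by rewrite ger_pMr ?pi_gt0.
have [tn1|tn1] := leP t n.+1%:R.
  by rewrite big_ord_recr mulrA mulr_ge0 ?subr_ge0// IHn// t0.
have -> : sin (pi * t) * \prod_(i < n.+1) (i.+1%:R - t) = (t - 1) *
    (sin (pi * (t - 1)) * \prod_(i < n) (i.+1%:R - (t - 1))).
  rewrite big_ord_recl.
  rewrite (eq_bigr (fun i : 'I_n => i.+1%:R - (t - 1))); last first.
    by move=> i _; rewrite lift0 -(natr1 i.+1); ring.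
  have -> : pi * t = pi * (t - 1) + pi by ring.
  by rewrite sinDpi /=; ring.
have t1 : 1 <= t.
  by rewrite (le_trans _ (ltW tn1))// -[1]/(1%:R) ler_nat.
rewrite mulr_ge0 ?subr_ge0// IHn// subr_ge0 t1/= lerBlDr.
by rewrite natr1.
Qed.

(** The factors with [i < k] have absolute value at most [k - i], with product [k!]; the others are
    at most [i + 1 - k], with product [(n - k)!]. *)
Lemma norm_prod_le_fact n k t : (k <= n)%N -> k%:R <= t <= k.+1%:R ->
  `|\prod_(i < n) (i.+1%:R - t)| <= (k`! * (n - k)`!)%:R.
Proof.
elim: n k t => [|n IHn] k t.
  by rewrite leqn0 => /eqP-> _; rewrite big_ord0 normr1.
rewrite leq_eqVlt ltnS => /predU1P[-> |kn] /andP[kt tk].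
  rewrite big_ord_recl (eq_bigr (fun i : 'I_n => i.+1%:R - (t - 1))); last first.
    by move=> i _; rewrite lift0 -(natr1 i.+1); ring.
  have t1 : 1 <= t by rewrite (le_trans _ kt)// -[1]/(1%:R) ler_nat.
  rewrite normrM subnn muln1 factS natrM ler_pM//.
    by rewrite distrC ger0_norm ?subr_ge0// lerBlDr natr1.
  have := IHn n (t - 1) (leqnn n); rewrite subnn muln1; apply.
  by rewrite lerBrDr natr1 kt lerBlDr natr1.
rewrite big_ord_recr normrM subSn// factS mulnCA natrM mulrC ler_pM//=.
  have tn : t <= n.+1%:R by rewrite (le_trans tk)// ler_nat ltnS.
  rewrite ger0_norm ?subr_ge0// -subSn//; rewrite natrB; first exact: lerB.
  by rewrite ltnW.
by apply: IHn => //; rewrite kt.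
Qed.

(* The [k]th of the [n + 1] binomial weights is the largest one. *)
Lemma binomial_mode x n k : 0 < x < 1 -> (k <= n)%N ->
  k%:R <= x * n.+1%:R <= k.+1%:R ->
  1 <= n.+1%:R * ('C(n, k)%:R * x ^+ k * (1 - x) ^+ (n - k)).
Proof.
move=> /andP[x0 x1] kn /andP[kx xk].
have y0 : 0 < 1 - x by rewrite subr_gt0.
pose T i := 'C(n, i)%:R * x ^+ i * (1 - x) ^+ (n - i).
have T0 i : 0 <= T i by rewrite !mulr_ge0// exprn_ge0// ltW.
have TS i : (i < n)%N -> T i.+1 * (i.+1%:R * (1 - x)) = T i * ((n - i)%:R * x).
  move=> lin; have := mul_bin_left n i; move/(congr1 (fun m => m%:R : R)).
  rewrite -(subnSK lin) !natrM /T => binS.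
  rewrite -(subnSK lin) !exprS.
  transitivity (i.+1%:R * 'C(n, i.+1)%:R * x * x ^+ i *
    (1 - x) * (1 - x) ^+ (n - i.+1)); first by ring.
  by rewrite binS; ring.
(* By [TS], [T i.+1] and [T i] compare as [x * n.+1] and [i.+1] do, so the weights increase up to
   [k] and decrease afterwards. *)
have diffE i : (i < n)%N ->
    (n - i)%:R * x - i.+1%:R * (1 - x) = x * n.+1%:R - i.+1%:R.
  by move=> lin; rewrite natrB ?(ltnW lin)// -!natr1; ring.
have Tup i : (i < k)%N -> T i <= T i.+1.
  move=> ik; have lin := leq_trans ik kn.
  have p0 : 0 < i.+1%:R * (1 - x) by rewrite mulr_gt0.
  rewrite -(ler_pM2r p0) TS// ler_wpM2l// -subr_ge0 diffE//.
  by rewrite subr_ge0 (le_trans _ kx)// ler_nat.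
have Tdown i : (k <= i < n)%N -> T i.+1 <= T i.
  move=> /andP[ki lin].
  have p0 : 0 < i.+1%:R * (1 - x) by rewrite mulr_gt0.
  rewrite -(ler_pM2r p0) TS// ler_wpM2l// -subr_le0 diffE//.
  by rewrite subr_le0 (le_trans xk)// ler_nat.
have Tmode i : (i <= n)%N -> T i <= T k.
  move=> lein; have [ik|ki] := leqP i k.
    have {ik lein} : exists j, k = (i + j)%N by exists (k - i)%N; lia.
    case=> j kE; rewrite kE in Tup *; clear -Tup.
    elim: j Tup => [|j IHj] Tup; first by rewrite addn0.
    rewrite (le_trans (IHj _))//; last by rewrite addnS Tup// addnS.
    by move=> h hj; apply: Tup; lia.
  have [j iE] : exists j, i = (k + j)%N by exists (i - k)%N; lia.
  rewrite iE in lein *; clear -Tdown lein.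
  elim: j lein => [|j IHj] lein; first by rewrite addn0.
  by rewrite addnS (le_trans (Tdown _ _)) ?IHj//; lia.
have sumT : \sum_(i < n.+1) T i = 1.
  have := exprDn (1 - x) x n; rewrite subrK expr1n => ->.
  by apply: eq_bigr => i _; rewrite /T -mulr_natl; ring.
rewrite -[leLHS]sumT (le_trans (ler_sum _ _ : _ <= \sum_(i < n.+1) T k))//.
  by move=> i _; rewrite Tmode// -ltnS.
by rewrite sumr_const card_ord mulr_natl.
Qed.

Lemma ratio_coef_sin_ge0 al n : 0 < al < 1 ->
  0 <= ratio_coef al (al - 1) n * sin (n.+1%:R * (pi * (1 - al))).
Proof.
move=> /andP[al0 al1]; rewrite /ratio_coef falling_rev mulrAC.
rewrite divr_ge0// mulrC.
have -> : n.+1%:R * (pi * (1 - al)) = pi * ((1 - al) * n.+1%:R) by ring.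
rewrite sin_prod_ge0// mulr_ge0 ?subr_ge0 ?(ltW al1)//=.
by rewrite ler_piMl// lerBlDl lerDr ltW.
Qed.

(* This is the limit of [b_fun al] at [0]. *)
Definition coef_radius al := (al `^ al * (1 - al) `^ (1 - al))^-1.

Lemma coef_radius_gt0 al : 0 < al < 1 -> 0 < coef_radius al.
Proof.
by move=> /andP[? ?]; rewrite invr_gt0 mulr_gt0// powR_gt0// subr_gt0.
Qed.

(** Trades the integer exponents of a binomial weight for the real ones of [coef_radius]; rounding
    costs a factor [1 / a]. *)
Lemma expr_le_powR (a : R) n m : 0 < a < 1 -> a * n%:R - 1 <= m%:R ->
  a ^+ m <= (a `^ a) ^+ n / a.
Proof.
move=> /andP[a0 a1] anm.
have -> : (a `^ a) ^+ n / a = a `^ (a * n%:R - 1).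
  rewrite powRB ?(gt_eqF a0) ?implybT// powRr1 ?ltW// powRrM.
  by rewrite powR_mulrn ?powR_ge0.
by rewrite -powR_mulrn ?(ltW a0)// ger_powR// a0 ltW.
Qed.

(** With [k] the integer part of [be * n.+1], the coefficient is at most [1 / 'C(n, k)] in absolute
    value. As [k] is the mode of the binomial law of parameter [be], this is at most
    [n.+1 * be ^+ k * al ^+ (n - k)], and the two powers amount to [coef_radius al ^- n.+1] up to
    [1 / (al * be)]. *)
Lemma ratio_coef_bound al n : 0 < al < 1 ->
  `|ratio_coef al (al - 1) n| * coef_radius al ^+ n.+1
  <= n.+1%:R / (al * (1 - al)).
Proof.
move=> /andP[al0 al1]; set be := 1 - al.
have be0 : 0 < be by rewrite subr_gt0.
have be1 : be < 1 by rewrite ltrBlDl ltrDr.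
have bal : 1 - be = al by rewrite /be opprB addrC subrK.
pose t := be * n.+1%:R; pose k := Num.truncn t.
have t0 : 0 <= t by rewrite mulr_ge0// ltW.
have /andP[kt tk] : k%:R <= t < k.+1%:R by apply: truncn_itv.
have kn : (k <= n)%N.
  rewrite -ltnS -(ltr_nat R) (le_lt_trans kt)// gtr_pMl//.
have ktk : k%:R <= t <= k.+1%:R by rewrite kt ltW.
have := @binomial_mode be n k; rewrite be0 be1 bal => /(_ isT kn ktk) mode.
have C0 : 0 < 'C(n, k)%:R :> R by rewrite ltr0n bin_gt0.
have s_le : `|ratio_coef al (al - 1) n| <= n.+1%:R * (be ^+ k * al ^+ (n - k)).
  rewrite /ratio_coef falling_rev normrM normfV normr_nat.
  have p_le := norm_prod_le_fact kn ktk.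
  rewrite (le_trans (ler_wpM2r _ p_le))// ?invr_ge0//.
  rewrite -(bin_fact kn) mulnC natrM -/be.
  rewrite [X in X <= _](_ : _ = 'C(n, k)%:R^-1); last first.
    rewrite natrM; have := factr_neq0 R k; have := factr_neq0 R (n - k).
    have := lt0r_neq0 C0; move=> c0 f1 f2; field.
    by rewrite c0 f1 f2.
  by rewrite -(ler_pM2l C0) divff ?lt0r_neq0// (le_trans mode)//; lra.
have al_le : al ^+ (n - k) <= (al `^ al) ^+ n.+1 / al.
  apply: expr_le_powR; rewrite ?al0//.
  have -> : al = 1 - be by rewrite bal.
  rewrite natrB// -subr_ge0 (_ : _ - _ = t - k%:R) ?subr_ge0//.
  by rewrite /t -natr1; ring.
have be_le : be ^+ k <= (be `^ be) ^+ n.+1 / be.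
  apply: expr_le_powR; rewrite ?be0//.
  by rewrite lerBlDr natr1 ltW.
rewrite (le_trans (ler_wpM2r _ s_le))//.
  by rewrite exprn_ge0// ltW// coef_radius_gt0// al0.
rewrite -mulrA ler_wpM2l//.
have abn0 : 0 < (al `^ al * be `^ be) ^+ n.+1.
  by rewrite exprn_gt0// mulr_gt0// powR_gt0.
rewrite /coef_radius exprVn ler_pdivrMr// exprMn.
rewrite [leRHS](_ : _ = (be `^ be) ^+ n.+1 / be * ((al `^ al) ^+ n.+1 / al)).
  by apply: ler_pM => //; rewrite exprn_ge0// ltW.
by field; rewrite !lt0r_neq0.
Qed.

End CoefficientEstimates.

(** * Real power series *)

Section CauchyProduct.
Variable R : realType.
Implicit Types u v : R^nat.

Definition convolution u v n := \sum_(k < n.+1) u k * v (n - k)%N.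

Lemma series_convolution u v N :
  series (convolution u v) N = \sum_(i < N) u i * series v (N - i)%N.
Proof.
elim: N => [|N IHN]; first by rewrite /series /= big_geq// big_ord0.
rewrite seriesSr IHN big_ord_recr /= subSn// subnn /convolution big_ord_recr /=.
rewrite subnn [in RHS]seriesSr {3}/series /= big_geq// add0r addrA; congr (_ + _).
rewrite -big_split /=; apply: eq_bigr => i _.
by rewrite subSn 1?ltnW// seriesSr mulrDr.
Qed.

(** The error is the sum of [u i * v j] over [i, j < N] with [i + j >= N]; the right-hand side is
    the same sum for absolute values. *)
Let series_conv_err u v N : `|series u N * series v N - series (convolution u v) N|
  <= series (Num.norm \o u) N * series (Num.norm \o v) N
     - series (convolution (Num.norm \o u) (Num.norm \o v)) N.
Proof.
have errE u' v' : series u' N * series v' N - series (convolution u' v') N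
    = \sum_(i < N) u' i * (series v' N - series v' (N - i)%N).
  rewrite series_convolution {1}/series /= big_mkord mulr_suml -sumrB.
  by apply: eq_bigr => i _; rewrite mulrBr.
rewrite !errE (le_trans (ler_norm_sum _ _ _))//; apply: ler_sum => i _.
rewrite normrM ler_wpM2l// !sub_series_geq ?leq_subr//.
exact: ler_norm_sum.
Qed.

Let half_cvg : (fun n => n./2) @ \oo --> \oo.
Proof.
move=> A [N _ AN]; exists N.*2 => // n /= Nn; apply: AN => /=.
by rewrite -[N]doubleK half_leq.
Qed.

(** For absolute values, the triangle [i + j < N] contains the square [i, j < N./2], so the error
    lies below a difference of two products of partial sums with the same limit. *)
Lemma cvg_series_convolution u v :
  cvgn (series (Num.norm \o u)) -> cvgn (series (Num.norm \o v)) ->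
  series (convolution u v) @ \oo --> limn (series u) * limn (series v).
Proof.
move=> cu cv; set u' := Num.norm \o u in cu *; set v' := Num.norm \o v in cv *.
have ndu : nondecreasing_seq (series u').
  by apply: nondecreasing_series => n _ _; rewrite /= normr_ge0.
have ndv : nondecreasing_seq (series v').
  by apply: nondecreasing_series => n _ _; rewrite /= normr_ge0.
have u'0 n : 0 <= u' n by exact: normr_ge0.
have u0 n : 0 <= series u' n by apply: sumr_ge0 => i _; exact: normr_ge0.
have v0 n : 0 <= series v' n by apply: sumr_ge0 => i _; exact: normr_ge0.
have conv_ge N : series u' N./2 * series v' N./2 <= series (convolution u' v') N.
  rewrite series_convolution [X in X * _]/series /= big_mkord mulr_suml.
  have hN : (N./2 <= N)%N by lia.
  rewrite [leRHS](_ : _ = \sum_(i < N | true) u' i * series v' (N - i)%N)//.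
  rewrite (big_ord_widen _ (fun i => u' i * series v' N./2) hN) big_mkcond /=.
  apply: ler_sum => i _; case: ifPn => [iN|_]; last by rewrite mulr_ge0.
  by rewrite ler_wpM2l//; apply: ndv; lia.
have uvcvg : (fun N => series u' N * series v' N - series u' N./2 * series v' N./2)
    @ \oo --> (0 : R).
  rewrite -[X in _ --> X](subrr (limn (series u') * limn (series v'))).
  apply: cvgB; first exact: cvgM.
  by apply: cvgM; apply: (cvg_comp _ _ half_cvg).
have errcvg : (fun N => series u N * series v N - series (convolution u v) N)
    @ \oo --> (0 : R).
  apply: norm_cvg0; apply: (squeeze_cvgr _ (cvg_cst 0) uvcvg).
  near=> N; rewrite normr_ge0 (le_trans (series_conv_err _ _ _))//.
  by rewrite lerB.
rewrite -[X in _ --> X]subr0.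
rewrite (_ : series (convolution u v) = fun N => series u N * series v N -
    (series u N * series v N - series (convolution u v) N)); last first.
  by apply/funext => N; rewrite opprB addrC subrK.
by apply: cvgB => //; apply: cvgM; exact: normed_cvg.
Unshelve. all: by end_near. Qed.

End CauchyProduct.

Section PowerSeries.
Variable R : realType.
Implicit Types (a b : R^nat) (r x t : R).

Definition psum a x := limn (pseries a x).

(** Bounded terms, rather than convergence: by Abel's lemma both say that the radius of convergence
    is at least [r], and bounds are easier to propagate through operations on coefficients. *)
Definition radius_ge r a := forall t, 0 <= t < r ->
  exists K, forall n, `|a n| * t ^+ n <= K.

Lemma radius_ge_norm_cvg r a x : radius_ge r a -> `|x| < r ->
  cvgn (series (Num.norm \o (fun n => a n * x ^+ n))).
Proof.
move=> ra xr; pose t := (`|x| + r) / 2.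
have xt : `|x| < t by rewrite /t; lra.
have t0 : 0 < t by rewrite (le_lt_trans _ xt).
have [|K aK] := ra t; first by rewrite ltW//= /t; lra.
have K0 : 0 <= K by rewrite (le_trans _ (aK 0%N))// mulr_ge0.
apply: (@series_le_cvg _ _ (geometric K (`|x| / t))) => [n|n|n|].
- exact: normr_ge0.
- by rewrite /geometric /= mulr_ge0// exprn_ge0// divr_ge0// ltW.
- rewrite /geometric /= normrM normrX exprMn exprVn mulrCA.
  by rewrite [leLHS]mulrC ler_wpM2l ?exprn_ge0// ler_pdivlMr ?exprn_gt0.
- apply: is_cvg_geometric_series.
  by rewrite normrM normr_id normfV (gtr0_norm t0) ltr_pdivrMr// mul1r.
Qed.

Lemma radius_ge_cvg r a x : radius_ge r a -> `|x| < r -> cvgn (pseries a x).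
Proof. by move=> ra xr; apply: normed_cvg; exact: radius_ge_norm_cvg ra xr. Qed.

(** Each of the [n.+1] terms of the geometric sum up to [t ^+ n] is at least [t ^+ n]. The bound
    absorbs linear factors when [t] is compared with a larger radius. *)
Lemma natr_mul_exp_bound t n : 0 <= t < 1 -> n.+1%:R * t ^+ n <= (1 - t)^-1.
Proof.
move=> /andP[t0 t1]; have t1' : 0 < 1 - t by rewrite subr_gt0.
rewrite -[leRHS]mul1r ler_pdivlMr// mulrC.
apply: (@le_trans _ _ ((1 - t) * \sum_(i < n.+1) t ^+ i)).
  rewrite ler_pM2l// mulr_natl -[n.+1 in leLHS]card_ord -sumr_const.
  apply: ler_sum => i _; apply: ler_wiXn2l; rewrite ?(ltW t1)//.
  by rewrite -ltnS.
by rewrite -[leLHS]opprK -mulNr opprB -subrX1 opprB gerBl exprn_ge0.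
Qed.

Lemma radius_ge_diffs r a : radius_ge r a -> radius_ge r (pseries_diffs a).
Proof.
move=> ra t /andP[t0 tr]; pose s := (t + r) / 2.
have ts : t < s by rewrite /s; lra.
have s0 : 0 < s by rewrite (le_lt_trans _ ts).
have [|K aK] := ra s; first by rewrite ltW//= /s; lra.
have K0 : 0 <= K by rewrite (le_trans _ (aK 0%N))// mulr_ge0.
have q0 : 0 <= t / s by rewrite divr_ge0// ltW.
have q1 : t / s < 1 by rewrite ltr_pdivrMr// mul1r.
exists ((1 - t / s)^-1 * (K / s)) => n.
rewrite /pseries_diffs normrM normr_nat.
rewrite [leLHS](_ : _ = n.+1%:R * (t / s) ^+ n * (`|a n.+1| * s ^+ n.+1 / s)).
  apply: ler_pM; rewrite ?mulr_ge0 ?exprn_ge0 ?invr_ge0 ?(ltW s0)//.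
    by rewrite natr_mul_exp_bound// q0.
  by rewrite ler_wpM2r// invr_ge0 ltW.
rewrite exprMn exprVn exprS; field.
by rewrite lt0r_neq0//= expf_neq0// lt0r_neq0.
Qed.

Lemma radius_ge_shift r a : radius_ge r a -> radius_ge r (fun n => a n.+1).
Proof.
move=> /radius_ge_diffs ra t tr; have [K aK] := ra t tr; exists K => n.
rewrite (le_trans _ (aK n))// /pseries_diffs normrM normr_nat.
case/andP: tr => t0 _; rewrite ler_wpM2r ?exprn_ge0// ler_peMl//.
by rewrite -[1]/(1%:R) ler_nat.
Qed.

Lemma radius_geMr r a b : radius_ge r a -> (forall n, `|b n| <= 1) ->
  radius_ge r (fun n => a n * b n).
Proof.
move=> ra b1 t tr; have [K aK] := ra t tr; exists K => n.
rewrite (le_trans _ (aK n))// normrM ler_wpM2r ?ler_piMr//.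
by case/andP: tr => t0 _; rewrite exprn_ge0.
Qed.

Lemma radius_geZ r a c : radius_ge r a -> radius_ge r (fun n => c * a n).
Proof.
move=> ra t tr; have [K aK] := ra t tr; exists (`|c| * K) => n.
by rewrite normrM -mulrA ler_wpM2l.
Qed.

Lemma radius_ge_convolution r a b : radius_ge r a -> radius_ge r b ->
  radius_ge r (convolution a b).
Proof.
move=> ra rb t /andP[t0 tr]; pose s := (t + r) / 2.
have ts : t < s by rewrite /s; lra.
have s0 : 0 < s by rewrite (le_lt_trans _ ts).
have sr : 0 <= s < r by rewrite ltW//= /s; lra.
have [A aA] := ra s sr; have [B bB] := rb s sr.
have q : 0 <= t / s < 1 by rewrite divr_ge0 ?(ltW s0)//= ltr_pdivrMr// mul1r.
exists ((1 - t / s)^-1 * (A * B)) => n.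
apply: (@le_trans _ _ ((n.+1%:R * (t / s) ^+ n) * (A * B))); last first.
  by rewrite ler_wpM2r ?natr_mul_exp_bound// mulr_ge0//;
    [rewrite (le_trans _ (aA 0%N))|rewrite (le_trans _ (bB 0%N))];
    rewrite ?mulr_ge0.
rewrite -[t in leLHS](divfK (lt0r_neq0 s0)) exprMn.
rewrite mulrCA [leRHS](_ : _ = (t / s) ^+ n * (n.+1%:R * (A * B))); last by ring.
rewrite ler_wpM2l ?exprn_ge0//; first by case/andP: q.
apply: (@le_trans _ _ (\sum_(k < n.+1) A * B)); last first.
  by rewrite sumr_const card_ord mulr_natl.
rewrite (le_trans (ler_wpM2r _ (ler_norm_sum _ _ _))) ?exprn_ge0 ?(ltW s0)//.
rewrite mulr_suml; apply: ler_sum => k _.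
have kn : (k <= n)%N by rewrite -ltnS.
rewrite normrM -[n in s ^+ n](subnKC kn) exprD mulrACA.
by apply: ler_pM; rewrite ?aA ?bB// mulr_ge0// exprn_ge0// ltW.
Qed.

Lemma is_derive_psum r a x : radius_ge r a -> `|x| < r ->
  is_derive x (1 : R) (psum a) (psum (pseries_diffs a) x).
Proof.
move=> ra xr; pose t := (`|x| + r) / 2.
have r0 : 0 < r by rewrite (le_lt_trans _ xr).
have tr : `|t| < r.
  by rewrite ger0_norm /t; [lra|rewrite divr_ge0// addr_ge0 ?(ltW r0)].
have xt : `|x| < `|t| by rewrite (lt_le_trans _ (ler_norm _))// /t; lra.
apply: (@pseries_snd_diffs _ _ t) => //; apply: radius_ge_cvg tr => //.
  exact: radius_ge_diffs.
by do 2 apply: radius_ge_diffs.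
Qed.

Lemma psumM r a b x : radius_ge r a -> radius_ge r b -> `|x| < r ->
  psum a x * psum b x = psum (convolution a b) x.
Proof.
move=> ra rb xr; apply/esym/cvg_lim => //.
rewrite (_ : pseries (convolution a b) x =
    series (convolution (fun n => a n * x ^+ n) (fun n => b n * x ^+ n))).
  exact: cvg_series_convolution (radius_ge_norm_cvg ra xr)
    (radius_ge_norm_cvg rb xr).
congr series; apply/funext => n.
rewrite /convolution /= mulr_suml; apply: eq_bigr => k _.
by rewrite mulrACA -exprD subnKC// -ltnS.
Qed.

Lemma psumD r a b x : radius_ge r a -> radius_ge r b -> `|x| < r ->
  psum (fun n => a n + b n) x = psum a x + psum b x.
Proof.
move=> ra rb xr; apply/cvg_lim => //.
rewrite (_ : pseries _ x = pseries a x \+ pseries b x); last first.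
  apply/funext => N; rewrite /pseries /series /= -big_split/=.
  by apply: eq_bigr => i _; rewrite mulrDl.
by apply: cvgD; [exact: radius_ge_cvg ra xr|exact: radius_ge_cvg rb xr].
Qed.

Lemma psumZ r a c x : radius_ge r a -> `|x| < r ->
  psum (fun n => c * a n) x = c * psum a x.
Proof.
move=> ra xr; apply/cvg_lim => //.
rewrite (_ : pseries _ x = (fun N => c * pseries a x N)); last first.
  apply/funext => N; rewrite /pseries /series /= mulr_sumr.
  by apply: eq_bigr => i _; rewrite mulrA.
by apply: cvgMr; exact: radius_ge_cvg ra xr.
Qed.

Lemma psum_shift r a x : radius_ge r a -> `|x| < r ->
  psum a x = a 0%N + x * psum (fun n => a n.+1) x.
Proof.
move=> ra xr; apply/cvg_lim => //.
rewrite -(cvg_shiftS (pseries a x)).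
rewrite (_ : (fun _ => _) = (fun N => a 0%N + x * pseries (fun n => a n.+1) x N)).
  apply: cvgD; first exact: cvg_cst.
  by apply: cvgMr; apply: radius_ge_cvg xr; exact: radius_ge_shift.
apply/funext => N; rewrite /pseries /series /= big_nat_recl// expr0 mulr1.
by congr (_ + _); rewrite mulr_sumr; apply: eq_bigr => i _; rewrite exprS mulrCA.
Qed.

Lemma psum0 a : psum a 0 = a 0%N.
Proof.
apply/cvg_lim => //; rewrite -(cvg_shiftS (pseries a 0)).
rewrite (_ : (fun _ => _) = cst (a 0%N)); first exact: cvg_cst.
apply/funext => N; rewrite /pseries /series /= big_nat_recl// expr0 mulr1.
by rewrite big1 ?addr0// => i _; rewrite exprS mul0r mulr0.
Qed.

Lemma psum_ge0 r a x : radius_ge r a -> 0 <= x < r ->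
  (forall n, 0 <= a n) -> 0 <= psum a x.
Proof.
move=> ra /andP[x0 xr] a0; apply: limr_ge.
  by apply: radius_ge_cvg ra _; rewrite ger0_norm.
near=> N; rewrite /pseries /series /= sumr_ge0// => i _.
by rewrite mulr_ge0// exprn_ge0.
Unshelve. all: by end_near. Qed.

End PowerSeries.

(** * The argument of y *)

Section ComplexExponential.
Variable R : realType.
Implicit Types (f : R -> R) (r x y : R).

Lemma derive0_eq r f x : (forall y, `|y| < r -> is_derive y (1 : R) f 0) ->
  0 <= x < r -> f x = f 0.
Proof.
move=> df /andP[]; rewrite le_eqVlt => /predU1P[<-//|x0] xr.
have yr y : y \in `[0, x] -> `|y| < r.
  by rewrite in_itv/= => /andP[y0 yx]; rewrite ger0_norm// (le_lt_trans yx).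
have [||c _] := @MVT R f (fun=> 0) 0 x x0.
- by move=> y yx; apply: df; apply: yr; exact: subset_itv_oo_cc yx.
- apply: derivable_within_continuous => y yx.
  by have [] := df _ (yr _ yx).
- by rewrite mul0r => /eqP; rewrite subr_eq0 => /eqP.
Qed.

(* [Y - iZ] solves the linear equation of [exp (c (p - iv))]. *)
Lemma complex_exp_unique r (c : R) (p v p' v' Y Z : R -> R) x :
  (forall y, `|y| < r -> is_derive y (1 : R) p (p' y)) ->
  (forall y, `|y| < r -> is_derive y (1 : R) v (v' y)) ->
  (forall y, `|y| < r -> is_derive y (1 : R) Y (c * (p' y * Y y - v' y * Z y))) ->
  (forall y, `|y| < r -> is_derive y (1 : R) Z (c * (v' y * Y y + p' y * Z y))) ->
  p 0 = 0 -> v 0 = 0 -> Y 0 = 1 -> Z 0 = 0 -> 0 <= x < r ->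
  Y x = expR (c * p x) * cos (c * v x) /\ Z x = expR (c * p x) * sin (c * v x).
Proof.
move=> dp dv dY dZ p0 v0 Y0 Z0 xr.
(* [G1] and [G2] are the real and imaginary parts of exp (- c (p - iv)) (Y - iZ), which is
   constant. *)
pose G1 y := expR (- c * p y) * (cos (c * v y) * Y y + sin (c * v y) * Z y).
pose G2 y := expR (- c * p y) * (sin (c * v y) * Y y - cos (c * v y) * Z y).
have G1E : G1 x = G1 0.
  apply: derive0_eq xr => y yr.
  have dpy := dp y yr; have dvy := dv y yr.
  have dYy := dY y yr; have dZy := dZ y yr.
  apply: is_derive_eq; rewrite /GRing.scale /=; ring.
have G2E : G2 x = G2 0.
  apply: derive0_eq xr => y yr.
  have dpy := dp y yr; have dvy := dv y yr.
  have dYy := dY y yr; have dZy := dZ y yr.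
  apply: is_derive_eq; rewrite /GRing.scale /=; ring.
move: G1E G2E; rewrite /G1 /G2 p0 v0 Y0 Z0 !mulr0 expR0 cos0 sin0.
rewrite !mulr1 addr0 subrr !mul1r mulNr expRN => G1E G2E.
have e0 : expR (c * p x) != 0 by rewrite gt_eqF// expR_gt0.
have cs := cos2Dsin2 (c * v x).
have {}G1E : cos (c * v x) * Y x + sin (c * v x) * Z x = expR (c * p x).
  by rewrite -[RHS]mulr1 -G1E mulVKf.
have {}G2E : sin (c * v x) * Y x - cos (c * v x) * Z x = 0.
  by apply/(mulfI (invr_neq0 e0)); rewrite G2E mulr0.
set C := cos (c * v x) in cs G1E G2E *; set S := sin (c * v x) in cs G1E G2E *.
split.
  transitivity (C * (C * Y x + S * Z x) + S * (S * Y x - C * Z x)).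
    by rewrite -[LHS]mul1r -cs; ring.
  by rewrite G1E G2E mulr0 addr0 mulrC.
transitivity (S * (C * Y x + S * Z x) - C * (S * Y x - C * Z x)).
  by rewrite -[LHS]mul1r -cs; ring.
by rewrite G1E G2E mulr0 subr0 mulrC.
Qed.

End ComplexExponential.

(** * Convergence of the series and the equation for the argument *)

Section InverseSeries.
Variable R : realType.
Implicit Types (s b : R^nat) (r x c : R).

(** A power series solution of f' = c s f converges where s does. If [S] is the sum of the
    [|s k| * t ^+ k], then [n.+1 * w n.+1] is at most [|c| * t * S] times the maximum of the earlier
    [w]. Once [n.+1] exceeds [|c| * t * S], no term surpasses all its predecessors, and the sum of
    the first [N] terms bounds everything. *)
Lemma radius_ge_exp r c s b : radius_ge r s ->
  (forall n, n.+1%:R * b n.+1 = c * convolution s b n) -> radius_ge r b.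
Proof.
move=> rs bS t /andP[t0 tr].
have tr' : `|t| < r by rewrite ger0_norm.
have cvs := radius_ge_norm_cvg rs tr'.
pose u k := `|s k| * t ^+ k.
have uE : Num.norm \o (fun n => s n * t ^+ n) = u.
  by apply/funext => n /=; rewrite normrM (ger0_norm (exprn_ge0 _ t0)).
have u0 k : 0 <= u k by rewrite mulr_ge0// exprn_ge0.
rewrite uE in cvs; set S := limn (series u) in cvs.
have uS N : \sum_(k < N) u k <= S.
  rewrite -(big_mkord xpredT) -/(series u N); apply: nondecreasing_cvgn_le => //.
  exact: nondecreasing_series.
have S0 : 0 <= S by have := uS 0%N; rewrite big_ord0.
pose w n := `|b n| * t ^+ n.
have w0 k : 0 <= w k by rewrite mulr_ge0// exprn_ge0.
pose C := `|c| * t * S; pose N := (Num.truncn C).+1.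
have CN : C <= N%:R by apply: ltW; rewrite truncnS_gt.
pose K := \sum_(k < N) w k.
have K0 : 0 <= K by exact: sumr_ge0.
have wS n : n.+1%:R * w n.+1 <= `|c| * t * \sum_(k < n.+1) u k * w (n - k)%N.
  have -> : n.+1%:R * w n.+1 = `|c * convolution s b n| * t ^+ n.+1.
    by rewrite -bS normrM normr_nat mulrA.
  rewrite normrM exprS mulrACA ler_wpM2l ?mulr_ge0// /convolution.
  rewrite (le_trans (ler_wpM2r _ (ler_norm_sum _ _ _))) ?exprn_ge0// mulr_suml.
  apply: ler_sum => k _; rewrite normrM /u /w mulrACA -exprD subnKC//.
  by rewrite -ltnS.
exists K; elim/ltn_ind => n IHn; rewrite -/(w n).
have [nN|Nn] := ltnP n N.
  by rewrite /K (bigD1 (Ordinal nN))//= lerDl sumr_ge0.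
case: n Nn IHn => // n Nn IHn.
have n0 : 0 < n.+1%:R :> R by [].
rewrite -(ler_pM2l n0) (le_trans (wS n))//.
apply: (@le_trans _ _ (`|c| * t * (\sum_(k < n.+1) u k * K))).
  rewrite ler_wpM2l ?mulr_ge0//; apply: ler_sum => k _.
  by rewrite ler_wpM2l// IHn// ltnS leq_subr.
rewrite -mulr_suml mulrA ler_wpM2r//.
apply: le_trans (_ : C <= _); first by rewrite /C ler_wpM2l ?mulr_ge0.
by rewrite (le_trans CN)// ler_nat.
Qed.

Variable al : R.
Hypothesis al01 : 0 < al < 1.

Let phi := pi * (1 - al).
Let s := ratio_coef al (al - 1).
Local Notation M := (coef_radius al).

(* The coefficients of [ln y], where [y = 1 + z y^al]. *)
Definition log_coef n := if n is m.+1 then s m / n%:R else 0.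

(* At [z = x exp (- i phi)] the series [ln y] is [log_modulus x - i angle x]. *)
Definition modulus_coef n := log_coef n * cos (n%:R * phi).
Definition angle_coef n := log_coef n * sin (n%:R * phi).

Lemma angle_coef_ge0 n : 0 <= angle_coef n.
Proof.
case: n => [|n]; first by rewrite /angle_coef mul0r.
by rewrite /angle_coef /= mulrAC divr_ge0// ratio_coef_sin_ge0.
Qed.

(** Later coefficients may vanish with the sine; this one alone makes the derivative of [angle]
    strictly positive. *)
Lemma angle_coef1_gt0 : 0 < angle_coef 1.
Proof.
move: al01 => /andP[al0 al1].
rewrite /angle_coef /log_coef /s /ratio_coef /falling big_ord0 fact0 !divr1 !mul1r.
rewrite sin_gt0_pi// /phi mulr_gt0 ?pi_gt0 ?subr_gt0//=.
by rewrite gtr_pMr ?pi_gt0// ltrBlDl ltrDr.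
Qed.

Lemma radius_ratio_coef : radius_ge M s.
Proof.
have M0 := coef_radius_gt0 al01; move: (al01) => /andP[al0 al1] t /andP[t0 tM].
have q0 : 0 <= t / M by rewrite divr_ge0// ltW.
have q1 : t / M < 1 by rewrite ltr_pdivrMr// mul1r.
have be0 : 0 < 1 - al by rewrite subr_gt0.
exists ((1 - t / M)^-1 * (al * (1 - al) * M)^-1) => n.
have /(ler_wpM2r (exprn_ge0 n t0)) := ratio_coef_bound n al01.
rewrite -/s => sn.
have Mn0 : 0 < M ^+ n.+1 by rewrite exprn_gt0.
rewrite -(ler_pM2r Mn0) mulrAC (le_trans sn)//.
rewrite [leLHS](_ : _ = n.+1%:R * (t / M) ^+ n *
    ((al * (1 - al) * M)^-1 * M ^+ n.+1)).
  rewrite -[leRHS]mulrA ler_wpM2r//.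
    by rewrite mulr_ge0 ?invr_ge0 ?mulr_ge0 // ltW.
  by rewrite natr_mul_exp_bound// q0.
rewrite exprMn exprVn exprS; field.
by rewrite expf_neq0 !lt0r_neq0.
Qed.

Lemma pseries_diffs_log_coef : pseries_diffs log_coef = s.
Proof.
by apply/funext => n; rewrite /pseries_diffs /= mulrCA divff ?mulr1// pnatr_eq0.
Qed.

Lemma log_coefS n : n.+1%:R * log_coef n.+1 = s n.
Proof. by rewrite -pseries_diffs_log_coef. Qed.

Lemma radius_log_coef : radius_ge M log_coef.
Proof.
move=> t tM; have [K sK] := radius_ratio_coef tM.
have t0 : 0 <= t by case/andP: tM.
exists (K * t) => -[|n].
  by rewrite normr0 mul0r mulr_ge0// (le_trans _ (sK 0%N))// mulr_ge0.
rewrite /= normrM normfV normr_nat exprSr mulrA ler_wpM2r//.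
rewrite (le_trans _ (sK n))// ler_wpM2r ?exprn_ge0//.
by rewrite ler_piMr// invf_le1// -[1]/(1%:R) ler_nat.
Qed.

Lemma radius_power_coef c : radius_ge M (power_coef al c).
Proof.
apply: (radius_ge_exp radius_ratio_coef) => n; exact: power_coef_recurrence.
Qed.

Let cos_bound n : `|cos (n%:R * phi)| <= 1. Proof. exact: cos_max. Qed.
Let sin_bound n : `|sin (n%:R * phi)| <= 1. Proof. exact: sin_max. Qed.

Lemma radius_modulus_coef : radius_ge M modulus_coef.
Proof. exact: radius_geMr radius_log_coef cos_bound. Qed.

Lemma radius_angle_coef : radius_ge M angle_coef.
Proof. exact: radius_geMr radius_log_coef sin_bound. Qed.

(** At z = x exp (- i phi) one has y^c = Y - iZ, where Y and Z have the coefficients [re_coef c] and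
    [im_coef c]. *)
Let re_coef c n := power_coef al c n * cos (n%:R * phi).
Let im_coef c n := power_coef al c n * sin (n%:R * phi).

Let radius_re c : radius_ge M (re_coef c).
Proof. by apply: radius_geMr => //; exact: radius_power_coef. Qed.

Let radius_im c : radius_ge M (im_coef c).
Proof. by apply: radius_geMr => //; exact: radius_power_coef. Qed.

(** Real part of [power_coef_recurrence]: the phase [n.+1 * phi] splits into [k.+1 * phi], which
    goes to the derivative of log y, and [(n - k) * phi], which goes to y^c. *)
Let diffs_re c : pseries_diffs (re_coef c) = (fun n =>
  c * convolution (pseries_diffs modulus_coef) (re_coef c) n +
  - c * convolution (pseries_diffs angle_coef) (im_coef c) n).
Proof.
apply/funext => n; rewrite {1}/pseries_diffs /re_coef mulrA power_coef_recurrence.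
rewrite mulNr -mulrBr -mulrA; congr (_ * _).
rewrite mulr_suml -sumrB; apply: eq_bigr => k _.
have -> : n.+1%:R * phi = k.+1%:R * phi + (n - k)%:R * phi.
  by rewrite -mulrDl -natrD addSn subnKC// -ltnS.
rewrite cosD /pseries_diffs /modulus_coef /angle_coef -/s.
rewrite -[s k]log_coefS.
by rewrite /im_coef; ring.
Qed.

Let diffs_im c : pseries_diffs (im_coef c) = (fun n =>
  c * convolution (pseries_diffs angle_coef) (re_coef c) n +
  c * convolution (pseries_diffs modulus_coef) (im_coef c) n).
Proof.
apply/funext => n; rewrite {1}/pseries_diffs /im_coef mulrA power_coef_recurrence.
rewrite -mulrDr -mulrA; congr (_ * _).
rewrite mulr_suml -big_split; apply: eq_bigr => k _ /=.
have -> : n.+1%:R * phi = k.+1%:R * phi + (n - k)%:R * phi.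
  by rewrite -mulrDl -natrD addSn subnKC// -ltnS.
rewrite sinD /pseries_diffs /modulus_coef /angle_coef -/s.
rewrite -[s k]log_coefS.
by rewrite /re_coef; ring.
Qed.

Definition log_modulus := psum modulus_coef.
Definition angle := psum angle_coef.

(** Both sides solve the linear system of [complex_exp_unique] with the same initial values. The
    modulus and the angle do not depend on [c], which is what relates y to y^al. *)
Lemma power_series_exp c x : 0 <= x < M ->
  psum (re_coef c) x = expR (c * log_modulus x) * cos (c * angle x) /\
  psum (im_coef c) x = expR (c * log_modulus x) * sin (c * angle x).
Proof.
have rp := radius_modulus_coef; have rv := radius_angle_coef.
have rY := radius_re c; have rZ := radius_im c.
have rp' := radius_ge_diffs rp; have rv' := radius_ge_diffs rv.
have dp y : `|y| < M ->
    is_derive y (1 : R) log_modulus (psum (pseries_diffs modulus_coef) y).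
  exact: is_derive_psum rp.
have dv y : `|y| < M ->
    is_derive y (1 : R) angle (psum (pseries_diffs angle_coef) y).
  exact: is_derive_psum rv.
have dY y : `|y| < M -> is_derive y (1 : R) (psum (re_coef c))
    (c * (psum (pseries_diffs modulus_coef) y * psum (re_coef c) y -
          psum (pseries_diffs angle_coef) y * psum (im_coef c) y)).
  move=> yM; apply: (is_derive_eq (is_derive_psum rY yM)); rewrite diffs_re.
  rewrite (psumD _ _ yM); [|exact: radius_geZ (radius_ge_convolution _ _)..].
  rewrite !(psumZ _ _ yM); [|exact: radius_ge_convolution..].
  by rewrite -!(psumM _ _ yM)// mulNr mulrBr.
have dZ y : `|y| < M -> is_derive y (1 : R) (psum (im_coef c))
    (c * (psum (pseries_diffs angle_coef) y * psum (re_coef c) y +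
          psum (pseries_diffs modulus_coef) y * psum (im_coef c) y)).
  move=> yM; apply: (is_derive_eq (is_derive_psum rZ yM)); rewrite diffs_im.
  rewrite (psumD _ _ yM); [|exact: radius_geZ (radius_ge_convolution _ _)..].
  rewrite !(psumZ _ _ yM); [|exact: radius_ge_convolution..].
  by rewrite -!(psumM _ _ yM)// mulrDr.
apply: (complex_exp_unique dp dv dY dZ).
- by rewrite /log_modulus psum0 /modulus_coef mul0r.
- by rewrite /angle psum0 /angle_coef mul0r.
- by rewrite psum0 /re_coef mul0r cos0 mulr1.
- by rewrite psum0 /im_coef mul0r sin0 mulr0.
Qed.

Let angle_equation x : 0 <= x < M ->
  sin (angle x) = x * expR (al * log_modulus x) * sin ((1 - al) * (pi - angle x)) /\
  expR (log_modulus x) * sin (angle x) =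
    x * expR (al * log_modulus x) * sin (al * (pi - angle x)).
Proof.
move=> x0M; have xM : `|x| < M by case/andP: x0M => x0 xM; rewrite ger0_norm.
have rY := radius_re al; have rZ := radius_im al.
have [Y1 Z1] := power_series_exp 1 x0M; have [Y2 Z2] := power_series_exp al x0M.
(* [reS] and [imS] are the real and the negated imaginary part of y = 1 + z y^al; the index shift in
   [power_coef1S] releases the factor exp (- i phi) of z. *)
have reS : psum (re_coef 1) x = 1 +
    x * (cos phi * psum (re_coef al) x + - sin phi * psum (im_coef al) x).
  rewrite (psum_shift (radius_re 1) xM) /re_coef mul0r cos0 mulr1 -/re_coef.
  rewrite -(psumZ _ rY xM) -(psumZ _ rZ xM) -(psumD _ _ xM);
    [|exact: radius_geZ|exact: radius_geZ].
  congr (_ + _ * psum _ _); apply/funext => n.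
  by rewrite power_coef1S -natr1 mulrDl mul1r cosD /re_coef /im_coef; ring.
have imS : psum (im_coef 1) x =
    x * (sin phi * psum (re_coef al) x + cos phi * psum (im_coef al) x).
  rewrite (psum_shift (radius_im 1) xM) /im_coef mul0r sin0 mulr0 add0r -/im_coef.
  rewrite -(psumZ _ rY xM) -(psumZ _ rZ xM) -(psumD _ _ xM);
    [|exact: radius_geZ|exact: radius_geZ].
  congr (_ * psum _ _); apply/funext => n.
  by rewrite power_coef1S -natr1 mulrDl mul1r sinD /re_coef /im_coef; ring.
move: reS imS; rewrite Y1 Z1 Y2 Z2 !mul1r.
move: (log_modulus x) (angle x) => p v.
set E := expR (al * p) => reE imE.
have sin_al : sin (al * (pi - v)) = sin phi * cos (al * v) + cos phi * sin (al * v).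
  have -> : al * (pi - v) = pi - (phi + al * v) by rewrite /phi; ring.
  by rewrite sinB sinpi cospi sinD; ring.
have sin_be : sin ((1 - al) * (pi - v)) =
    sin phi * cos (v - al * v) - cos phi * sin (v - al * v).
  have -> : (1 - al) * (pi - v) = phi - (v - al * v) by rewrite /phi; ring.
  exact: sinB.
split; last by rewrite imE sin_al; ring.
(* This is the imaginary part of [y = 1 + z y^al] multiplied by [exp (iv)]. *)
rewrite sin_be cosB sinB.
have : cos v * (expR p * sin v) - sin v * (expR p * cos v) = 0 by ring.
rewrite imE reE => h; apply/eqP; rewrite -subr_eq0; apply/eqP.
by rewrite -[RHS]oppr0 -h; ring.
Qed.

(** The two sine ratios equal [x * expR ((al - 1) * p)] and [x * expR (al * p)] with
    [p = log_modulus x]. Raised to the powers [al] and [1 - al], the exponentials cancel and the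
    powers of [x] add up to [x]. *)
Lemma b_fun_angle x : 0 < x < M -> 0 < angle x < pi -> b_fun al (pi - angle x) = x.
Proof.
move=> /andP[x0 xM] /andP[v0 vpi]; move: (al01) => /andP[al0 al1].
have be0 : 0 < 1 - al by rewrite subr_gt0.
have x0M : 0 <= x < M by rewrite ltW.
have [E1 E2] := angle_equation x0M.
set u := pi - angle x in E1 E2 *.
have u0 : 0 < u by rewrite subr_gt0.
have upi : u < pi by rewrite ltrBlDr ltrDl.
have sin_gt0 a : 0 < a <= 1 -> 0 < sin (a * u).
  move=> /andP[a0 a1]; rewrite sin_gt0_pi// mulr_gt0//=.
  by rewrite (le_lt_trans _ upi)// ger_pMl.
have sal : 0 < sin (al * u) by rewrite sin_gt0// al0 ltW.
have sbe : 0 < sin ((1 - al) * u) by rewrite sin_gt0// be0 lerBlDr lerDl ltW.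
have sinu : sin u = sin (angle x) by rewrite /u sinB sinpi cospi; ring.
have e0 := expR_gt0 (log_modulus x).
have ratio_al : sin u / sin (al * u) = x * expR ((al - 1) * log_modulus x).
  apply: (mulIf (lt0r_neq0 sal)); rewrite divfK ?lt0r_neq0// sinu.
  apply: (mulfI (lt0r_neq0 e0)); rewrite E2 mulrBl mul1r expRB; field.
  by rewrite lt0r_neq0.
have ratio_be : sin u / sin ((1 - al) * u) = x * expR (al * log_modulus x).
  by rewrite sinu E1 mulfK// lt0r_neq0.
rewrite /b_fun ratio_al ratio_be !powRM ?expR_ge0 ?(ltW x0)// -!expRM.
rewrite mulrACA -expRD -powRD; last by rewrite (gt_eqF x0) implybT.
have -> : al + (1 - al) = 1 by ring.
have -> : (al - 1) * log_modulus x * al + al * log_modulus x * (1 - al) = 0 by ring.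
by rewrite powRr1 ?ltW// expR0 mulr1.
Qed.

End InverseSeries.

(** * Monotonicity and range of the Kanter function *)

Section KanterFunction.
Variable R : realType.
Implicit Types (a u t x y al : R).

Lemma derive_gt0_lt (f df : R -> R) x y : x < y ->
  (forall t, x <= t <= y -> is_derive t (1 : R) f (df t)) ->
  (forall t, x < t < y -> 0 < df t) -> f x < f y.
Proof.
move=> xy dfE df0.
have [||c cxy fE] := @MVT R f df x y xy.
- by move=> t txy; apply: dfE; exact: subset_itv_oo_cc txy.
- by apply: derivable_within_continuous => t txy; have [] := dfE _ txy.
- by rewrite -subr_gt0 fE mulr_gt0 ?subr_gt0//; apply: df0.
Qed.

Let sin_scaled_gt0 a t : 0 < a < 1 -> 0 < t < pi -> 0 < sin (a * t).
Proof.
move=> /andP[a0 a1] /andP[t0 tpi]; rewrite sin_gt0_pi// mulr_gt0//=.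
by rewrite (lt_trans _ tpi)// gtr_pMl.
Qed.

Lemma sin_lt_id t : 0 < t < pi -> sin t < t.
Proof.
move=> /andP[t0 tpi]; rewrite -subr_gt0 -[X in X < _](subr0 0) -{2}sin0.
apply: (@derive_gt0_lt (fun s => s - sin s) (fun s => 1 - cos s)) => //= s.
move=> /andP[s0 st]; rewrite subr_gt0 -cos0 ltr_cos// in_itv/= ?lexx ?pi_ge0//.
by rewrite ltW// ltW// (lt_trans st).
Qed.

Lemma cos_lt_sinc t : 0 < t < pi -> t * cos t < sin t.
Proof.
move=> /andP[t0 tpi]; rewrite -subr_gt0 -[X in X < _](subr0 0).
rewrite -{1}sin0 -[X in _ - X](mul0r (cos 0)).
apply: (@derive_gt0_lt (fun s => sin s - s * cos s) (fun s => s * sin s)) => //= s.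
  by move=> _; apply: is_derive_eq; rewrite /GRing.scale /=; ring.
by move=> /andP[s0 st]; rewrite mulr_gt0// sin_gt0_pi// s0 (lt_trans st).
Qed.

Lemma sin_scaled_gt a t : 0 < a < 1 -> 0 < t < pi -> a * sin t < sin (a * t).
Proof.
move=> /andP[a0 a1] /andP[t0 tpi]; rewrite -subr_gt0.
have -> : 0 = sin (a * 0) - a * sin 0 :> R by rewrite !(mulr0, sin0) subrr.
apply: (@derive_gt0_lt (fun s => sin (a * s) - a * sin s)
  (fun s => a * (cos (a * s) - cos s))) => //= s.
  by move=> _; apply: is_derive_eq; rewrite /GRing.scale /=; ring.
move=> /andP[s0 st]; rewrite mulr_gt0// subr_gt0 ltr_cos ?gtr_pMl// in_itv/=;
  apply/andP; split.
- by rewrite mulr_ge0// ltW.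
- by rewrite (le_trans _ (ltW (lt_trans st tpi)))// ger_pMl// ltW.
- exact: ltW.
- exact/ltW/(lt_trans st).
Qed.

Lemma sin_ratio_decr a x y : 0 < a < 1 -> 0 < x -> x < y -> y < pi ->
  sin y / sin (a * y) < sin x / sin (a * x).
Proof.
move=> a01 x0 xy ypi; move: (a01) => /andP[a0 a1].
(* [G] is the numerator of the derivative of [- (sin s / sin (a * s))]; it vanishes at 0 and has a
   positive derivative. *)
pose G s := a * (sin s * cos (a * s)) - cos s * sin (a * s).
have G0 t : 0 < t < pi -> 0 < G t.
  move=> /andP[t0 tpi].
  have <- : G 0 = 0 by rewrite /G mulr0 sin0 mulr0 mul0r mulr0 subrr.
  apply: (@derive_gt0_lt _ (fun s => (1 - a ^+ 2) * (sin s * sin (a * s)))) => //= s.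
    by move=> _; apply: is_derive_eq; rewrite /GRing.scale /=; ring.
  move=> /andP[s0 st]; have spi := lt_trans st tpi.
  rewrite !mulr_gt0 ?sin_scaled_gt0 ?sin_gt0_pi ?s0//.
  by rewrite subr_gt0 expr_lt1// ltW.
rewrite -ltrN2.
apply: (@derive_gt0_lt (fun s => - (sin s / sin (a * s)))
  (fun s => G s / sin (a * s) ^+ 2)) => // s.
  move=> /andP[xs sy]; have s0pi : 0 < s < pi.
    by rewrite (lt_le_trans x0)//= (le_lt_trans sy).
  have sn0 : sin (a * s) != 0 by rewrite gt_eqF// sin_scaled_gt0.
  by apply: is_derive_eq; rewrite /GRing.scale /= /G; field.
move=> /andP[xs sy]; have s0pi : 0 < s < pi.
  by rewrite (lt_trans x0)//= (lt_trans sy).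
by rewrite divr_gt0 ?G0// exprn_gt0// sin_scaled_gt0.
Qed.

Variable al : R.
Hypothesis al01 : 0 < al < 1.
Local Notation be := (1 - al).
Local Notation M := (coef_radius al).

Let be01 : 0 < be < 1.
Proof. by case/andP: al01 => al0 al1; rewrite subr_gt0 al1/= ltrBlDl ltrDr. Qed.

Let al_gt0 : 0 < al. Proof. by case/andP: al01. Qed.
Let be_gt0 : 0 < be. Proof. by case/andP: be01. Qed.

Let ratio_gt0 a u : 0 < a < 1 -> 0 < u < pi -> 0 < sin u / sin (a * u).
Proof. by move=> a01 u0pi; rewrite divr_gt0 ?sin_scaled_gt0 ?sin_gt0_pi. Qed.

Let powR_lt r x y : 0 < r -> 0 < x -> x < y -> x `^ r < y `^ r.
Proof.
move=> r0 x0 xy; apply: gt0_ltr_powR; rewrite ?nnegrE//; first exact: ltW.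
exact/ltW/(lt_trans x0).
Qed.

Let powR_le r x y : 0 < r -> 0 < x -> x <= y -> x `^ r <= y `^ r.
Proof.
move=> r0 x0 xy; apply: ge0_ler_powR; rewrite ?nnegrE//; try exact: ltW.
exact/ltW/(lt_le_trans x0).
Qed.

Lemma b_fun_gt0 u : 0 < u < pi -> 0 < b_fun al u.
Proof. by move=> u0pi; rewrite mulr_gt0// powR_gt0// ratio_gt0. Qed.

Lemma b_fun_decr x y : 0 < x -> x < y -> y < pi -> b_fun al y < b_fun al x.
Proof.
move=> x0 xy ypi.
have x0pi : 0 < x < pi by rewrite x0 (lt_trans xy).
have y0pi : 0 < y < pi by rewrite (lt_trans x0).
rewrite /b_fun ltr_pM ?powR_ge0// powR_lt//.
- exact: ratio_gt0.
- exact: sin_ratio_decr.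
- exact: ratio_gt0.
- exact: sin_ratio_decr.
Qed.

Let coef_radiusE : M = al^-1 `^ al * be^-1 `^ be.
Proof.
have powRV x r : 0 < x -> x^-1 `^ r = (x `^ r)^-1.
  by move=> x0; rewrite -(powR_inv1 (ltW x0)) -powRrM mulN1r powRN.
by rewrite /coef_radius invfM (powRV _ _ al_gt0) (powRV _ _ be_gt0).
Qed.

Lemma b_fun_lt_radius u : 0 < u < pi -> b_fun al u < M.
Proof.
move=> u0pi; have H a : 0 < a < 1 -> sin u / sin (a * u) < a^-1.
  move=> a01; have /andP[a0 _] := a01.
  rewrite ltr_pdivrMr ?sin_scaled_gt0// mulrC ltr_pdivlMr// mulrC.
  exact: sin_scaled_gt.
rewrite coef_radiusE /b_fun ltr_pM ?powR_ge0// powR_lt//.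
- exact: ratio_gt0.
- exact: H.
- exact: ratio_gt0.
- exact: H.
Qed.

(** Quantifies the limit at 0: bound [sin (a * u)] by [a * u] in both denominators. The exponents
    sum to 1, so [sin u / u] comes out to the first power. *)
Lemma b_fun_ge u : 0 < u < pi -> M * (sin u / u) <= b_fun al u.
Proof.
move=> u0pi; have /andP[u0 upi] := u0pi.
have s0 : 0 < sin u by rewrite sin_gt0_pi.
have su0 : 0 < sin u / u by rewrite divr_gt0.
have H a : 0 < a < 1 -> a^-1 * (sin u / u) <= sin u / sin (a * u).
  move=> a01; have /andP[a0 a1] := a01.
  rewrite mulrCA -invfM ler_pM2l// lef_pV2 ?posrE ?sin_scaled_gt0 ?mulr_gt0//.
  apply/ltW/sin_lt_id; rewrite mulr_gt0//= (lt_trans _ upi)//.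
  by rewrite gtr_pMl.
have -> : sin u / u = (sin u / u) `^ al * (sin u / u) `^ be.
  rewrite -powRD; last by rewrite (gt_eqF su0) implybT.
  by rewrite addrC subrK powRr1// ltW.
have iA : 0 < al^-1 by rewrite invr_gt0.
have iB : 0 < be^-1 by rewrite invr_gt0.
rewrite coef_radiusE mulrACA -(powRM _ (ltW iA) (ltW su0)).
rewrite -(powRM _ (ltW iB) (ltW su0)) /b_fun.
apply: ler_pM; rewrite ?powR_ge0//; apply: powR_le => //.
- exact: mulr_gt0.
- exact: H.
- exact: mulr_gt0.
- exact: H.
Qed.

Lemma b_fun_near_radius x : 0 < x < M -> exists2 u, 0 < u < pi & x < b_fun al u.
Proof.
move=> /andP[x0 xM]; have M0 := coef_radius_gt0 al01.
have q0 : 0 < x / M by rewrite divr_gt0.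
have q1 : x / M < 1 by rewrite ltr_pdivrMr// mul1r.
(* The choice [u = acos (x / M)] works because [x / M = cos u < sin u / u]. *)
have u0pi : 0 < acos (x / M) < pi.
  rewrite acos_gt0 ?acos_ltpi ?(ltW q1) ?q1 ?andbT//.
    exact: lt_trans q0.
  exact/ltW/(lt_trans _ q0).
exists (acos (x / M)) => //.
apply: lt_le_trans (b_fun_ge u0pi).
rewrite mulrC -ltr_pdivrMr// ltr_pdivlMr; last by case/andP: u0pi.
rewrite mulrC -[X in _ * X < _]acosK; first exact: cos_lt_sinc.
by rewrite in_itv/= (ltW q1) andbT ltW// (lt_trans _ q0).
Qed.

Lemma angle0 : angle al 0 = 0.
Proof. by rewrite /angle psum0 /angle_coef mul0r. Qed.

Definition angle_deriv := psum (pseries_diffs (angle_coef al)).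

Lemma is_derive_angle x : `|x| < M -> is_derive x (1 : R) (angle al) (angle_deriv x).
Proof. by move=> xM; apply: is_derive_psum xM; exact: radius_angle_coef. Qed.

Lemma angle_deriv_gt0 x : 0 <= x < M -> 0 < angle_deriv x.
Proof.
move=> /andP[x0 xM]; have ra := radius_ge_diffs (radius_angle_coef al01).
have a0 n : 0 <= pseries_diffs (angle_coef al) n.
  by rewrite mulr_ge0// angle_coef_ge0.
rewrite /angle_deriv (psum_shift ra) ?ger0_norm// ltr_wpDr//.
  rewrite mulr_ge0// (psum_ge0 (radius_ge_shift ra)) ?x0//.
by rewrite /pseries_diffs mul1r angle_coef1_gt0.
Qed.

Lemma angle_incr x y : 0 <= x -> x < y -> y < M -> angle al x < angle al y.
Proof.
move=> x0 xy yM; apply: (derive_gt0_lt xy) => t /andP[xt ty].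
  by apply: is_derive_angle; rewrite ger0_norm ?(le_trans x0)// (le_lt_trans ty).
by apply: angle_deriv_gt0; rewrite (le_trans x0) ?(ltW xt)//= (lt_trans ty).
Qed.

(** Suppose that [angle] has reached [pi] at [x], and choose [u] with [b_fun al u > x]. By
    continuity [angle] takes the value [pi - u < pi] at some [y <= x], where [b_fun_angle] does
    apply and yields [b_fun al u = y <= x]. *)
Lemma angle_gt0_ltpi x : 0 < x < M -> 0 < angle al x < pi.
Proof.
move=> /andP[x0 xM]; apply/andP; split; first by rewrite -angle0 angle_incr.
rewrite ltNge; apply/negP => vpi.
have x0M : 0 < x < M by rewrite x0.
have [u /andP[u0 upi] xu] := b_fun_near_radius x0M.
have [||y] := @IVT R (angle al) 0 x (pi - u) (ltW x0).
- apply: derivable_within_continuous => t; rewrite in_itv/= => /andP[t0 tx].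
  by have [] := @is_derive_angle t _; rewrite ?ger0_norm// (le_lt_trans tx).
- rewrite angle0 minEle maxEle (le_trans _ vpi) ?pi_ge0//.
  by rewrite subr_ge0 (ltW upi)/= (le_trans _ vpi)// gerBl ltW.
rewrite in_itv/= => /andP[y0 yx] yE.
have y_gt0 : 0 < y.
  rewrite lt_neqAle y0 andbT; apply/eqP => y0'; move: yE.
  by rewrite -y0' angle0 => /esym/eqP; rewrite subr_eq0 gt_eqF.
have y0M : 0 < y < M by rewrite y_gt0 (le_lt_trans yx).
have v0pi : 0 < angle al y < pi by rewrite yE subr_gt0 upi/= gtrBl u0.
have := b_fun_angle al01 y0M v0pi; rewrite yE subKr => buy.
by rewrite buy ltNge yx in xu.
Qed.

Lemma b_fun_lt_angle x u : 0 < x < M -> 0 < u < pi ->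
  (b_fun al u < x) = (pi - angle al x < u).
Proof.
move=> x0M /andP[u0 upi]; have v0pi := angle_gt0_ltpi x0M.
have bE := b_fun_angle al01 x0M v0pi.
have w0 : 0 < pi - angle al x by rewrite subr_gt0; case/andP: v0pi.
have wpi : pi - angle al x < pi by rewrite ltrBlDr ltrDl; case/andP: v0pi.
have [wu|uw|<-] := ltgtP (pi - angle al x) u; last by rewrite bE ltxx.
  by rewrite -[X in _ < X]bE b_fun_decr.
by rewrite -[X in _ < X]bE; apply/negbTE; rewrite -leNgt ltW// b_fun_decr.
Qed.

End KanterFunction.

(** * Complete monotonicity and densities *)

Section ExponentialSeries.
Variables (R : realType) (r b : R).
Implicit Types (a : R^nat) (w c : R).

(** These are the coefficients after applying [b] times x d/dx, that is, - d/dw when x = exp (- b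
    w). *)
Lemma radius_ge_theta a : radius_ge r a -> radius_ge r (fun n => b * n%:R * a n).
Proof.
move=> ra t tr; have t0 : 0 <= t by case/andP: tr.
have [K aK] := radius_ge_diffs ra tr.
have K0 : 0 <= K by rewrite (le_trans _ (aK 0%N))// mulr_ge0.
exists (`|b| * (K * t)) => -[|n].
  by rewrite mulr0 mul0r normr0 mul0r !mulr_ge0.
rewrite -mulrA normrM -mulrA ler_wpM2l// exprSr mulrA ler_wpM2r//.
exact: aK.
Qed.

Lemma is_derive_exp_series a w : radius_ge r a -> expR (- b * w) < r ->
  is_derive w (1 : R) (fun z => psum a (expR (- b * z)))
    (- psum (fun n => b * n%:R * a n) (expR (- b * w))).
Proof.
move=> ra wr; have xr : `|expR (- b * w)| < r by rewrite ger0_norm ?expR_ge0.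
have da := is_derive_psum ra xr.
have de : is_derive w (1 : R) (fun z => expR (- b * z)) (- b * expR (- b * w)).
  by apply: is_derive_eq; rewrite /GRing.scale /=; ring.
have dc : is_derive w (1 : R) (psum a \o (fun z => expR (- b * z)))
    (psum (pseries_diffs a) (expR (- b * w)) * (- b * expR (- b * w))).
  exact: is_derive1_comp.
apply: (is_derive_eq dc).
rewrite (psum_shift (radius_ge_theta ra) xr) mulr0 mul0r add0r.
rewrite (_ : (fun n => b * n.+1%:R * a n.+1) = (fun n => b * pseries_diffs a n)).
  by rewrite (psumZ _ (radius_ge_diffs ra) xr) /GRing.scale /=; ring.
by apply/funext => n; rewrite -mulrA.
Qed.

Lemma exp_series_completely_monotone a c (f : R -> R) :
  0 <= b -> radius_ge r a -> (forall n, 0 <= a n) ->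
  (forall w, c < w -> expR (- b * w) < r) ->
  (forall w, c < w -> f w = psum a (expR (- b * w))) ->
  completely_monotone c f.
Proof.
move=> b0 ra a0 cr fE.
pose ak k n := (b * n%:R) ^+ k * a n.
have akS k : ak k.+1 = (fun n => b * n%:R * ak k n).
  by apply/funext => n; rewrite /ak exprS mulrA.
have rak k : radius_ge r (ak k).
  elim: k => [|k IHk]; last by rewrite akS; exact: radius_ge_theta.
  by rewrite (_ : ak 0%N = a)//; apply/funext => n; rewrite /ak mul1r.
pose E k w := (-1) ^+ k * psum (ak k) (expR (- b * w)).
(* The formula for the [k]th derivative holds only beyond [c]; this half-line is open, so the
   formula can be differentiated there through local agreement. *)
have dE k : (forall w, c < w -> derive1n k f w = E k w) ->
    forall w, c < w -> is_derive w (1 : R) (derive1n k f) (E k.+1 w).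
  move=> fk w cw; apply: (@near_eq_is_derive _ _ _ (E k)).
    by near=> z; rewrite fk//; near: z; exact: lt_nbhsr.
  have dp := is_derive_exp_series (rak k) (cr w cw).
  apply: is_derive_eq; rewrite /E akS exprS /GRing.scale /=; ring.
have H k w : c < w -> derive1n k f w = E k w.
  elim: k w => [|k IHk] w cw.
    rewrite /E mul1r /= fE//; congr (psum _ _).
    by apply/funext => n; rewrite /ak mul1r.
  by rewrite derive1nS derive1E; have [_ ->] := dE k IHk w cw.
move=> k w cw; split; first by have [] := dE k (H k) w cw.
rewrite H// /E mulrA -exprMn mulrNN mulr1 expr1n mul1r (psum_ge0 (rak k))//.
  by rewrite expR_ge0 cr.
by move=> n; rewrite mulr_ge0// exprn_ge0// mulr_ge0.
Unshelve. all: by end_near. Qed.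

End ExponentialSeries.

(** * Densities determined by tails *)

Section DensityFromTails.
Variable R : realType.
Local Notation mu := (@lebesgue_measure R).
Local Open Scope ereal_scope.

Lemma itvoy_bigcup (c : R) :
  \bigcup_n `](c + n.+1%:R^-1)%R, +oo[%classic = `]c, +oo[%classic :> set R.
Proof.
apply/seteqP; split => [x [n _]|x] /=; rewrite !in_itv/= !andbT => cx.
  by rewrite (le_lt_trans _ cx)// lerDl.
have [n nx] : exists n, (n.+1%:R^-1 < x - c)%R.
  exists (Num.truncn (x - c)^-1).
  by rewrite invf_plt ?posrE ?subr_gt0// truncnS_gt.
by exists n => //=; rewrite in_itv/= andbT -ltrBrDl.
Qed.

Lemma eq_tail_measure (m1 m2 : {measure set R -> \bar R}) (c : R) :
  (forall a, (c < a)%R -> m1 `]a, +oo[%classic = m2 `]a, +oo[%classic) ->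
  m1 `]c, +oo[%classic = m2 `]c, +oo[%classic.
Proof.
move=> m12; rewrite -itvoy_bigcup.
pose F n : set R := `](c + n.+1%:R^-1)%R, +oo[%classic.
have mF n : measurable (F n) by exact: measurable_itv.
have ndF : nondecreasing_seq F.
  move=> n m nm; apply/subsetPset => x; rewrite /F /= !in_itv/= !andbT.
  by apply: le_lt_trans; rewrite lerD2l lef_pV2 ?posrE// ler_nat.
have mUF := bigcupT_measurable F mF.
have := @nondecreasing_cvg_mu _ _ _ m1 F mF mUF ndF.
have -> : m1 \o F = m2 \o F.
  by apply/funext => n /=; apply: m12; rewrite ltrDl invr_gt0.
by move/cvg_lim => <- //; apply/cvg_lim => //; exact: nondecreasing_cvg_mu.
Qed.

(** Open right rays are stable under intersection and generate the Borel sets, so agreement on them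
    suffices. A ray starting below [c] is cut at [c]; both measures ignore the lower piece. *)
Lemma density_above (d : measure_display) (T : measurableType d)
    (P : probability T R) (X : {RV P >-> R}) (f : R -> R) (c : R) :
  measurable_fun [set: R] f -> (forall x, 0 <= f x)%R ->
  (forall x, x <= c -> f x = 0)%R ->
  distribution P X `]-oo, c]%classic = 0 ->
  (forall a, (c < a)%R -> distribution P X `]a, +oo[%classic =
    \int[mu]_(x in `]a, +oo[%classic) (f x)%:E) ->
  is_density X f.
Proof.
move=> mf f0 fc Xc Xa; split => //.
pose nu (A : set R) := \int[mu]_(x in A) (f x)%:E.
have nu0 : nu set0 = 0 by rewrite /nu integral_set0.
have nu_ge0 A : 0 <= nu A by apply: integral_ge0 => x _; rewrite lee_fin.
have nu_add : semi_sigma_additive nu.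
  move=> F mF tF mUF; rewrite /nu; apply: cvg_toP.
    apply: ereal_nondecreasing_is_cvgn => m n mn.
    by apply: lee_sum_nneg_natr => // k _ _; exact: nu_ge0.
  rewrite ge0_integral_bigcup//=.
  - by apply/measurable_EFinP; exact: measurable_funTS.
  - by move=> x _; rewrite lee_fin.
pose numx := isMeasure.Build _ _ _ nu nu0 nu_ge0 nu_add.
pose nuM : {measure set R -> \bar R} := HB.pack nu numx.
have nuc : nu `]-oo, c]%classic = 0.
  rewrite /nu (eq_integral (cst 0)) ?integral0// => x.
  by rewrite inE/= in_itv/= => xc; rewrite fc.
have tail_eq a : distribution P X `]a, +oo[%classic = nu `]a, +oo[%classic.
  have [ca|ac] := ltP c a; first exact: Xa.
  have tailc := @eq_tail_measure (distribution P X) nuM c Xa.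
  have splitE : `]a, +oo[%classic = `]a, c]%classic `|` `]c, +oo[%classic :> set R.
    by rewrite -itv_bndbnd_setU ?bnd_simp.
  have tailE (m : {measure set R -> \bar R}) :
      m `]-oo, c]%classic = 0 -> m `]a, +oo[%classic = m `]c, +oo[%classic.
    move=> mc; rewrite splitE measureU//=.
      have -> : m `]a, c]%classic = 0.
        apply: subset_measure0 mc => //=; apply: subset_itvr => //.
      by rewrite add0e.
    apply/seteqP; split => x //= [].
    by rewrite !in_itv/= andbT => /andP[_ xc]; rewrite ltNge xc.
  by rewrite (tailE (distribution P X) Xc) tailc -(tailE nuM nuc).
move=> A mA.
apply: (@measure_unique _ _ _ (@RGenOInfty.G R) (fun n => `](- n%:R)%R, +oo[%classic%R)
  _ _ _ _ (distribution P X) nuM) => //.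
- exact: RGenOInfty.measurableE.
- move=> _ _ [x ->] [y ->]; exists (Num.max x y).
  apply/seteqP; split => z /=; rewrite !in_itv/= !andbT gt_max; first by case=> -> ->.
  by move=> /andP.
- by move=> i; eexists.
- apply/seteqP; split => // x _; exists (Num.truncn (- x)).+1 => //=.
  by rewrite in_itv/= andbT ltrNl truncnS_gt.
- by move=> _ [a ->]; exact: tail_eq.
- move=> k; rewrite (le_lt_trans (probability_le1 _ _)) ?ltry//.
Qed.

End DensityFromTails.

(** * Tails and density of [W_fun] under the uniform law *)

Section UniformTails.
Variable R : realType.
Local Notation unif := (uniform_prob (pi_gt0 R)).

Lemma uniform_prob_itv (p q : R) : 0 <= p -> p <= q -> q <= pi ->
  unif `]p, q[%classic = ((q - p) / pi)%:E.
Proof.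
move=> p0 pq qpi; rewrite /uniform_prob.
rewrite (eq_integral (cst (pi^-1)%:E)); last first.
  move=> x; rewrite inE/= in_itv/= => /andP[px xq]; rewrite /uniform_pdf subr0.
  by rewrite (le_trans p0 (ltW px)) (le_trans (ltW xq) qpi).
rewrite integral_cst//= lebesgue_measure_itv/= lte_fin.
move: pq; rewrite le_eqVlt => /predU1P[->|->]; last by rewrite -EFinB -EFinM mulrC.
by rewrite ltxx subrr mul0r mule0.
Qed.

(** The interval []0, pi[] has full mass, so events about [W_fun] can be compared where its formula
    is meaningful. *)
Lemma uniform_prob_eq (A B : set R) : measurable A -> measurable B ->
  (forall u, 0 < u < pi -> A u <-> B u) -> unif A = unif B.
Proof.
move=> mA mB AB; pose I : set R := `]0, pi[%classic.
have mI : measurable I by exact: measurable_itv.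
have uI : unif (~` I) = 0%E.
  have uI1 : unif I = 1%E.
    by rewrite uniform_prob_itv ?pi_ge0// subr0 divff// gt_eqF// pi_gt0.
  by rewrite probability_setC// [X in (_ - X)%E]uI1 subee.
have unifI (C : set R) : measurable C -> unif C = unif (C `&` I).
  move=> mC; have -> : unif C = (unif (C `\` I) + unif (C `&` I))%E.
    exact: measureDI.
  have -> : unif (C `\` I) = 0%E; last by rewrite add0e.
  apply: (subset_measure0 _ _ _ uI); [exact: measurableD|exact: measurableC|].
  by move=> x [].
rewrite (unifI A)// (unifI B)//; congr (unif _).
apply/seteqP; split => u [Cu Iu]; split=> //; apply/AB => //;
  by move: Iu; rewrite /I /= in_itv.
Qed.

Variable al : R.
Hypothesis al01 : 0 < al < 1.
Local Notation be := (1 - al).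
Local Notation M := (coef_radius al).
Let c := ln (be * al `^ (al / be)).

Let al_gt0 : 0 < al. Proof. by case/andP: al01. Qed.
Let be_gt0 : 0 < be. Proof. by case/andP: al01 => _ al1; rewrite subr_gt0. Qed.

(** Under x = exp (- be w) the left end of the support corresponds to the bound [M] on x, so [w > c]
    means [x < M]. *)
Lemma coef_radius_expR : M = expR (- be * c).
Proof.
rewrite /c lnM ?posrE ?powR_gt0// ln_powR /coef_radius.
rewrite /powR !gt_eqF//= -expRD -expRN; congr expR.
by field; rewrite gt_eqF.
Qed.

Lemma W_fun_gtE a u : 0 < u < pi ->
  (a < W_fun al u) = (b_fun al u < expR (- be * a)).
Proof.
move=> u0pi; have b0 := b_fun_gt0 al01 u0pi.
rewrite /W_fun /V_fun ln_powR -{2}(lnK b0) ltr_expR !mulNr ltrNr.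
by rewrite (mulrC be^-1) ltr_pdivrMr// mulNr (mulrC a).
Qed.

Let preimage_measurable (A : set R) : measurable A -> measurable (W_fun al @^-1` A).
Proof. by move=> mA; rewrite -[X in measurable X]setTI; exact: measurable_W_fun. Qed.

Let exp_lt_radius a : c < a -> 0 < expR (- be * a) < M.
Proof.
by move=> ca; rewrite expR_gt0 coef_radius_expR ltr_expR !mulNr ltrN2 ltr_pM2l.
Qed.

Lemma uniform_W_tail a : c < a ->
  unif (W_fun al @^-1` `]a, +oo[%classic) = (angle al (expR (- be * a)) / pi)%:E.
Proof.
move=> ca; have xM := exp_lt_radius ca; set x := expR _ in xM *.
have /andP[v0 vpi] := angle_gt0_ltpi al01 xM.
have -> : angle al x / pi = (pi - (pi - angle al x)) / pi by rewrite subKr.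
rewrite -uniform_prob_itv// ?subr_ge0 ?gerBl ?(ltW v0) ?(ltW vpi)//.
apply: uniform_prob_eq => //; first exact: preimage_measurable.
move=> u u0pi; rewrite /= !in_itv/= andbT W_fun_gtE// b_fun_lt_angle//.
by case/andP: u0pi => _ ->; rewrite andbT.
Qed.

Lemma uniform_W_low : unif (W_fun al @^-1` `]-oo, c]%classic) = 0%E.
Proof.
rewrite -[RHS](measure0 unif); apply: uniform_prob_eq => //.
  exact: preimage_measurable.
move=> u u0pi; split => //=; rewrite in_itv/= leNgt W_fun_gtE//.
by rewrite -coef_radius_expR b_fun_lt_radius.
Qed.

(** At [c] the series would be evaluated at [M] itself, out of reach of [radius_ge]; the value 0 is
    used there and below. *)
Definition W_pdf w :=
  if c < w then psum (fun n => be * n%:R * (angle_coef al n / pi)) (expR (- be * w))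
  else 0.

Let pdf_coef_ge0 n : 0 <= be * n%:R * (angle_coef al n / pi).
Proof.
apply: mulr_ge0; first by rewrite mulr_ge0// ltW.
by rewrite divr_ge0 ?pi_ge0//; exact: angle_coef_ge0.
Qed.

Let radius_scaled_angle : radius_ge M (fun n => angle_coef al n / pi).
Proof.
rewrite (_ : (fun _ => _) = (fun n => pi^-1 * angle_coef al n)); last first.
  by apply/funext => n; rewrite mulrC.
exact/radius_geZ/radius_angle_coef.
Qed.

Let radius_pdf : radius_ge M (fun n => be * n%:R * (angle_coef al n / pi)).
Proof. exact: radius_ge_theta. Qed.

Lemma W_pdf_completely_monotone : completely_monotone c W_pdf.
Proof.
apply: (exp_series_completely_monotone (ltW be_gt0) radius_pdf pdf_coef_ge0).
  by move=> w /exp_lt_radius/andP[].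
by move=> w cw; rewrite /W_pdf cw.
Qed.

Lemma W_pdf_ge0 w : 0 <= W_pdf w.
Proof.
rewrite /W_pdf; case: ifPn => // cw; apply: (psum_ge0 radius_pdf) => //.
by have /andP[/ltW -> ->] := exp_lt_radius cw.
Qed.

Lemma derivable_W_pdf w : c < w -> derivable W_pdf w 1.
Proof. by move=> cw; have [] := @W_pdf_completely_monotone 0%N w cw. Qed.

Lemma measurable_W_pdf : measurable_fun [set: R] W_pdf.
Proof.
have -> : [set: R] = `]c, +oo[%classic `|` `]-oo, c]%classic.
  by apply/seteqP; split=> // x _ /=; rewrite !in_itv/= andbT;
    case: ltP; [left|right].
apply/measurable_funU => //; split.
  apply: open_continuous_measurable_fun => // x; rewrite inE/= in_itv/= andbT => cx.
  exact/differentiable_continuous/derivable1_diffP/derivable_W_pdf.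
apply: (eq_measurable_fun (cst (0 : R))) => [x|]; last exact: measurable_cst.
by rewrite inE/= in_itv/= /W_pdf ltNge => ->.
Qed.

(** Fundamental theorem of calculus on a ray: minus the tail is an antiderivative, and it tends to 0
    at infinity because x tends to 0 and the series has no constant term. *)
Lemma integral_W_pdf_tail a : c < a ->
  (\int[lebesgue_measure]_(x in `]a, +oo[%classic) (W_pdf x)%:E)%E =
  (angle al (expR (- be * a)) / pi)%:E.
Proof.
move=> ca; pose F w := - psum (fun n => angle_coef al n / pi) (expR (- be * w)).
have dF w : c < w -> is_derive w (1 : R) F (W_pdf w).
  move=> cw; have /andP[_ xM] := exp_lt_radius cw.
  have := is_derive_exp_series radius_scaled_angle xM => dp.
  by apply: is_derive_eq; rewrite /W_pdf cw opprK.
have angE x : 0 < x < M -> psum (fun n => angle_coef al n / pi) x = angle al x / pi.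
  move=> /andP[x0 xM]; rewrite mulrC -(psumZ _ (radius_angle_coef al01)).
    by congr (psum _ _); apply/funext => n; rewrite mulrC.
  by rewrite gtr0_norm.
have Fcvg : F x @[x --> +oo] --> (0 : R).
  have M0 : `|0 : R| < M by rewrite normr0 coef_radius_gt0.
  have ang0 : psum (fun n => angle_coef al n / pi) 0 = 0.
    by rewrite psum0 /angle_coef mul0r mul0r.
  have angcont : {for 0, continuous (psum (fun n => angle_coef al n / pi))}.
    apply/differentiable_continuous/derivable1_diffP.
    by have [] := is_derive_psum radius_scaled_angle M0.
  have ecvg : expR (- be * w) @[w --> +oo] --> (0 : R).
    under eq_fun do rewrite mulNr.
    apply: (@cvg_comp _ _ _ (fun w => be * w) (fun y => expR (- y))
      _ (pinfty_nbhs R)); last exact: cvgr_expR.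
    exact: gt0_cvgMry.
  rewrite -oppr0 -[X in - X]ang0; apply: cvgN.
  exact: cvg_comp ecvg angcont.
have Fcont w : c < w -> {for w, continuous F}.
  move=> cw; apply/differentiable_continuous/derivable1_diffP.
  by have [] := dF w cw.
rewrite integral_itv_obnd_cbnd; last first.
  by apply/measurable_EFinP; apply: measurable_funTS; exact: measurable_W_pdf.
rewrite (@ge0_continuous_FTC2y _ W_pdf F a 0) //.
- by rewrite sub0e /F -EFinN opprK angE// exp_lt_radius.
- by move=> x _; exact: W_pdf_ge0.
- apply: derivable_within_continuous => x; rewrite in_itv/= andbT => ax.
  exact/derivable_W_pdf/(lt_le_trans ca).
- by move=> x ax; have [] := dF x (lt_trans ca ax).
- exact/cvg_at_right_filter/Fcont.
- move=> x; rewrite in_itv/= andbT => ax.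
  by rewrite derive1E; have [_ ->] := dF x (lt_trans ca ax).
Qed.

End UniformTails.

(** * Support and density of [W_rv] *)

Unset Implicit Arguments.

Theorem theorem3p2 (R : realType) (alpha : R) (d : measure_display)
    (T : measurableType d) (P : probability T R) (U : {RV P >-> R})
    (alpha_gt0 : 0 < alpha) (alpha_lt1 : alpha < 1)
    (U_uniform : uniform_on_0_pi U) :
  let beta := 1 - alpha in
  let c := ln (beta * alpha `^ (alpha / beta)) in
  interior (support_rv (W_rv alpha U)) = [set x : R | c < x] /\
  exists f : R -> R,
    is_density (W_rv alpha U) f /\ completely_monotone c f.
Proof.
move=> beta c; have al01 : 0 < alpha < 1 by rewrite alpha_gt0.
have be0 : 0 < beta by rewrite subr_gt0.
have WE (A : set R) : measurable A -> distribution P (W_rv alpha U) A =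
    uniform_prob (pi_gt0 R) (W_fun alpha @^-1` A).
  move=> mA; rewrite -U_uniform//.
  by rewrite -[X in measurable X]setTI; exact: measurable_W_fun.
have Wtail a : c < a -> distribution P (W_rv alpha U) `]a, +oo[%classic =
    (angle alpha (expR (- beta * a)) / pi)%:E.
  by move=> ca; rewrite WE// uniform_W_tail.
have Wlow : distribution P (W_rv alpha U) `]-oo, c]%classic = 0%E.
  by rewrite WE// uniform_W_low.
split; last first.
  exists (W_pdf alpha); split; last exact: W_pdf_completely_monotone.
  apply: (@density_above _ _ _ P (W_rv alpha U) _ c) => //.
  - exact: measurable_W_pdf.
  - exact: W_pdf_ge0.
  - by move=> x xc; rewrite /W_pdf ltNge xc.
  - by move=> a ca; rewrite Wtail// integral_W_pdf_tail.
suff -> : support_rv (W_rv alpha U) = `[c, +oo[%classic.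
  rewrite interior_itv_bndy; apply/seteqP.
  by split => x /=; rewrite in_itv/= andbT.
apply/seteqP; split => [x supp|x] /=; rewrite in_itv/= andbT.
  rewrite leNgt; apply/negP => xc.
  (* The ball of radius [c - x] around [x] stays below [c], where there is no mass. *)
  have := supp (c - x); rewrite subr_gt0 => /(_ xc).
  rewrite (subset_measure0 _ _ _ Wlow) ?ltxx//.
    by rewrite ball_itv; exact: measurable_itv.
  move=> y; rewrite ball_itv /= !in_itv/= => /andP[_].
  by rewrite addrC subrK => /ltW.
move=> cx e e0; rewrite lt0e measure_ge0 andbT; apply/eqP => ball0.
(* The interval []a, b]] lies inside the ball and to the right of [c]. If it were null, the tails at
   [a] and [b] would agree, against the strict monotonicity of [angle]. *)
pose a := x + e / 3; pose b := x + e / 3 * 2.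
have xa : x < a by rewrite /a; lra.
have ab : a < b by rewrite /a /b; lra.
have bxe : b < x + e by rewrite /b; lra.
have ca := le_lt_trans cx xa; have cb := lt_trans ca ab.
have Wab : distribution P (W_rv alpha U) `]a, b]%classic = 0%E.
  apply: (subset_measure0 _ _ _ ball0) => //.
    by rewrite ball_itv; exact: measurable_itv.
  move=> y; rewrite ball_itv /= !in_itv/= => /andP[ay yb].
  apply/andP; split; last exact: le_lt_trans bxe.
  by rewrite (lt_trans _ (lt_trans xa ay))// gtrBl.
have := Wtail a ca.
rewrite (_ : `]a, +oo[%classic = `]a, b]%classic `|` `]b, +oo[%classic); last first.
  by rewrite -itv_bndbnd_setU// bnd_simp ?(ltW ab).
have -> : distribution P (W_rv alpha U) (`]a, b] `|` `]b, +oo[)%classic =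
    (distribution P (W_rv alpha U) `]a, b]%classic +
     distribution P (W_rv alpha U) `]b, +oo[%classic)%E.
  apply: measureU => //; apply/seteqP; split => y //= [].
  by rewrite !in_itv/= andbT => /andP[_ yb]; rewrite ltNge yb.
rewrite Wab add0e Wtail// => -[] /eqP; apply/negP; rewrite lt_eqF//.
rewrite ltr_pM2r ?invr_gt0 ?pi_gt0//; apply: (angle_incr al01); first exact: expR_ge0.
- by rewrite ltr_expR !mulNr ltrN2 ltr_pM2l.
- by rewrite coef_radius_expR// ltr_expR !mulNr ltrN2 ltr_pM2l.
Qed.
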